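(* Let $(M^n,\mathcal F)$ be a smooth foliation and let $U=\{u_\alpha\}_{\alpha\in A}$ be an open countable covering of $M^n$. Then the cohomologies of the double complex $K^{p,q}=\prod_{\alpha_0<\cdots<\alpha_p}\Lambda^q_{\mathcal F}(u_{\alpha_0\cdots\alpha_p})$, i.e. the cohomologies of the associated total complex $(K^*,D^* )$, are isomorphic to the vertical cohomologies $H^*_{\mathcal F}(M^n)$. The isomorphism $H^*_{\mathcal F}(M^n)\to H^*(K^*,D^* )$ is induced by the restriction mapping $r^*:\Lambda^*_{\mathcal F}(M^n)\to K^{0,*}=\prod_{\alpha_0}\Lambda^*_{\mathcal F}(u_{\alpha_0})\subset K^*$.
   Context: A smooth foliation $(M^n,\mathcal F)$ of dimension $k$ is a smooth $n$-manifold $M^n$ together with the partition $\mathcal F$ into leaves determined by a $k$-dimensional smooth involutive distribution $V\subset TM^n$. $S(V)$ denotes the smooth vector fields tangent to the leaves. $\Lambda^p_{\mathcal F}(M^n)$ is the module of smooth sections of the bundle of exterior $p$-forms on $V$ (equivalently, alternating $C^\infty(M^n)$-multilinear maps $S(V)^p\to C^\infty(M^n)$), with differential $$(d_{\mathcal F}^p\alpha)(X_1,\dots,X_{p+1})=\sum_{i}(-1)^{i-1}X_i\alpha(X_1,\dots,\widehat X_i,\dots,X_{p+1})+\sum_{i<j}(-1)^{i+j}\alpha([X_i,X_j],X_1,\dots,\widehat X_i,\dots,\widehat X_j,\dots,X_{p+1}).$$ The cohomology groups of $(\Lambda^*_{\mathcal F}(M^n),d^*_{\mathcal F})$ are the vertical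 cohomologies $H^*_{\mathcal F}(M^n)$. For an open set $u\subset M^n$, $\Lambda^q_{\mathcal F}(u)$ denotes the smooth sections over $u$ of the bundle of exterior $q$-forms on $V$ (vertical forms on $u$). The countable index set $A$ is totally ordered, and $u_{\alpha_0\cdots\alpha_p}=u_{\alpha_0}\cap\cdots\cap u_{\alpha_p}$. The difference operator $\delta=\delta^p:K^{p,q}\to K^{p+1,q}$ is $(\delta\omega)_{\alpha_0\cdots\alpha_{p+1}}=\sum_{i=0}^{p+1}(-1)^i\omega_{\alpha_0\cdots\widehat\alpha_i\cdots\alpha_{p+1}}$, where each term on the right is restricted to $u_{\alpha_0\cdots\alpha_{p+1}}$. The vertical maps of the double complex are $d^q_{\mathcal F}:K^{p,q}\to K^{p,q+1}$, acting componentwise. The total complex is $K^m=\bigoplus_{p+q=m}K^{p,q}$, with $D^m=\delta^p+(-1)^pd^q_{\mathcal F}$ on $K^{p,q}$. *)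

(* Defs.v *)
From HB Require Import structures.
From mathcomp Require Import all_boot all_order all_algebra.
From mathcomp Require Import generic_quotient ring_quotient.
From mathcomp Require Import all_classical all_reals all_analysis.
Set Implicit Arguments.
Unset Strict Implicit.
Unset Printing Implicit Defensive.
Import Order.TTheory GRing.Theory Num.Theory.
Import numFieldNormedType.Exports.
Local Open Scope classical_set_scope.
Local Open Scope ring_scope.
Local Open Scope quotient_scope.

Section SmoothEuclidean.
Context {R : realType} {n : nat}.
Implicit Types (O : set 'rV[R]_n) (f g : 'rV[R]_n -> R).

Fixpoint Ck (k : nat) O f : Prop :=
  (forall x, O x -> {for x, continuous f}) /\
  if k is k'.+1 then
    forall i : 'I_n,
      (forall x, O x -> derivable f x (delta_mx ord0 i)) /\
      Ck k' O ('D_(delta_mx ord0 i) f)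
  else True.

Definition smoothE O f : Prop := forall k, Ck k O f.

Lemma Ck_ext k O f g : open O -> (forall x, O x -> f x = g x) ->
  Ck k O f -> Ck k O g.
Proof.
move=> oO; elim: k f g => [|k IH] f g fg /= [cf Hf].
all: have nfg x : O x -> {near x, f =1 g}
  by move=> Ox; apply: filterS (open_nbhs_nbhs (conj oO Ox)).
all: have cg x : O x -> {for x, continuous g}
  by move=> Ox; rewrite /prop_for /continuous_at -(fg x Ox);
     apply: cvg_trans (cf x Ox); apply: near_eq_cvg (nfg x Ox).
  by split.
split=> // i; have [df Cf] := Hf i; split.
  by move=> x Ox; apply: near_eq_derivable (nfg x Ox) (df x Ox).
by apply: IH Cf => // x Ox; apply: near_eq_derive (nfg x Ox).
Qed.

Lemma Ck_lin k O (a : R) f g : open O -> Ck k O f -> Ck k O g ->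
  Ck k O (fun x => a * f x + g x).
Proof.
move=> oO; elim: k f g => [|k IH] f g /= [cf Hf] [cg Hg].
all: have c x : O x -> {for x, continuous (fun x => a * f x + g x)}
  by move=> Ox; apply: (@continuousD _ _ _ (fun x => a * f x) g);
     [apply: continuousM; [exact: cst_continuous|exact: cf] | exact: cg].
  by split.
split=> // i; have [df Cf] := Hf i; have [dg Cg] := Hg i.
have E : (fun x => a * f x + g x) = (a *: (f : _ -> R^o)) + (g : _ -> R^o) by [].
split=> [x Ox|].
  by rewrite E; apply: derivableD; [apply: derivableZ; exact: df | exact: dg].
apply: Ck_ext (IH _ _ Cf Cg) => // x Ox.
rewrite E deriveD; [|apply: derivableZ; exact: df|exact: dg].
by rewrite deriveZ; last exact: df.
Qed.

Lemma Ck_cst k O (a : R) : Ck k O (fun=> a).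
Proof.
elim: k a => [|k IH] a /=; split=> //; try by move=> x _; exact: cst_continuous.
move=> i.
split; first by move=> x _; exact: derivable_cst.
rewrite (_ : 'D__ _ = fun=> 0) //.
by apply/funext=> x; rewrite derive_cst.
Qed.

End SmoothEuclidean.

Record chart (R : realType) (n : nat) (M : topologicalType) := Chart {
  chart_dom : set M;
  chart_map : M -> 'rV[R]_n;
  chart_inv : 'rV[R]_n -> M;
  chart_img := chart_map @` chart_dom;
  chart_dom_open : open chart_dom;
  chart_img_open : open chart_img;
  chart_mapK : forall p, chart_dom p -> chart_inv (chart_map p) = p;
  chart_map_cont : forall p, chart_dom p -> {for p, continuous chart_map};
  chart_inv_cont : forall y, chart_img y -> {for y, continuous chart_inv}
}.

Record manifold (R : realType) (n : nat) := Manifold {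
  mfd_space :> topologicalType;
  mfd_hausdorff : hausdorff_space mfd_space;
  mfd_second_countable : @second_countable mfd_space;
  mfd_atlas : set (chart R n mfd_space);
  mfd_cover : forall p, exists2 c, mfd_atlas c & chart_dom c p;
  mfd_compat : forall c c' (i : 'I_n), mfd_atlas c -> mfd_atlas c' ->
    smoothE (chart_map c @` (chart_dom c `&` chart_dom c'))
      (fun y => chart_map c' (chart_inv c y) ord0 i)
}.

Section Manifold.
Context {R : realType} {n : nat} {M : manifold R n}.
Implicit Types (u w : set M) (p : M).

Local Notation fn := (M -> R^o).

(* Meant for open [w]; the values of [f] outside [w] are irrelevant. *)
Definition smooth_on w (f : fn) : Prop :=
  forall c, mfd_atlas c ->
    smoothE (chart_img c `&` chart_inv c @^-1` w) (f \o chart_inv c).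

Definition smooth_at p (f : fn) : Prop :=
  exists w, [/\ open w, w p & smooth_on w f].

(* A tangent vector at [p] is a derivation of the algebra of germs at [p] of
   smooth functions. It is represented by a functional on all functions which
   depends only on the germ and vanishes on the functions that are not smooth
   near [p], so that equal tangent vectors are equal as functionals. *)
Definition tvec : Type := fn -> R^o.
HB.instance Definition _ := GRing.Lmodule.on tvec.

Definition tangent p : set tvec := [set v : tvec | [/\
  forall f, ~ smooth_at p f -> v f = 0,
  forall f g, smooth_at p f -> smooth_at p g ->
    (\forall x \near p, f x = g x) -> v f = v g,
  forall (a : R) f g, smooth_at p f -> smooth_at p g ->
    v (a *: f + g) = a *: v f + v g &
  forall f g, smooth_at p f -> smooth_at p g ->
    v (fun x => f x * g x) = f p * v g + v f * g p]].

Definition vfield : Type := M -> tvec.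
HB.instance Definition _ := GRing.Lmodule.on vfield.

Definition smooth_vfield w (X : vfield) : Prop :=
  (forall p, w p -> tangent p (X p)) /\
  forall w' f, open w' -> w' `<=` w -> smooth_on w' f ->
    smooth_on w' (fun p => X p f).

Definition bracket (X Y : vfield) : vfield := fun p f =>
  if `[< smooth_at p f >] then X p (Y ^~ f) - Y p (X ^~ f) else 0.

Lemma chart_pre_open (c : chart R n M) w : open w ->
  open (chart_img c `&` chart_inv c @^-1` w).
Proof.
move=> ow; rewrite openE => y [cy wy]; apply: filterI.
  by apply: open_nbhs_nbhs; split=> //; exact: chart_img_open.
by apply: (chart_inv_cont cy); apply: open_nbhs_nbhs.
Qed.

Lemma smooth_on_lin w (a : R) (f g : fn) : open w ->
  smooth_on w f -> smooth_on w g -> smooth_on w (a *: f + g).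
Proof.
move=> ow sf sg c Ac k; apply: Ck_lin; first exact: chart_pre_open.
- exact: sf.
- exact: sg.
Qed.

Lemma smooth_on0 w : smooth_on w (0 : fn).
Proof. by move=> c Ac k; exact: Ck_cst. Qed.

Lemma CkS k (O O' : set 'rV[R]_n) f : O' `<=` O -> Ck k O f -> Ck k O' f.
Proof.
move=> OO'; elim: k f => [|k IH] f /= [cf Hf]; split=> //.
- by move=> x /OO'; exact: cf.
- by move=> x /OO'; exact: cf.
- by move=> i; have [df Cf] := Hf i; split; [move=> x /OO'; exact: df|exact: IH].
Qed.

Lemma smooth_onS w w' f : w' `<=` w -> smooth_on w f -> smooth_on w' f.
Proof.
move=> ww' sf c Ac k; apply: CkS (sf c Ac k) => y [cy wy].
by split=> //; exact: ww'.
Qed.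

Lemma smooth_on_ext w f g : open w -> (forall p, w p -> f p = g p) ->
  smooth_on w f -> smooth_on w g.
Proof.
move=> ow fg sf c Ac k; apply: Ck_ext (sf c Ac k); first exact: chart_pre_open.
by move=> y [_ wy] /=; exact: fg.
Qed.

Lemma smooth_vfieldS w w' X : w' `<=` w ->
  smooth_vfield w X -> smooth_vfield w' X.
Proof.
move=> ww' [tX sX]; split=> [p /ww'|w2 f ow2 s2]; first exact: tX.
by apply: sX => // p /s2 /ww'.
Qed.

Lemma tangent0 p : tangent p 0.
Proof.
split=> // [a f g _ _|f g _ _].
  by rewrite [RHS]addr0 [RHS]scaler0.
by rewrite [X in _ = _ * X + _](_ : _ = 0) // mulr0 mul0r addr0.
Qed.

End Manifold.

Arguments tvec {R n} M.
Arguments vfield {R n} M.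

(* [fol_dist p] is the fibre at [p] of the involutive distribution. The partition
   into leaves is determined by it and is not recorded. *)
Record foliation (R : realType) (n : nat) (M : manifold R n) (k : nat) :=
  Foliation {
  fol_dist : M -> set (tvec M);
  fol_frame : forall p : M, exists w (X : 'I_k -> vfield M), [/\
    open w, w p, forall i, smooth_vfield w (X i) &
    forall q, w q ->
      fol_dist q = [set v | exists a : 'I_k -> R, v = \sum_i a i *: X i q] /\
      forall a : 'I_k -> R, \sum_i a i *: X i q = 0 -> forall i, a i = 0];
  fol_involutive : forall w (X Y : vfield M), open w ->
    smooth_vfield w X -> smooth_vfield w Y ->
    (forall p, w p -> fol_dist p (X p)) ->
    (forall p, w p -> fol_dist p (Y p)) ->
    forall p, w p -> fol_dist p (bracket X Y p)
}.

Definition del (T : Type) (i : nat) (s : seq T) : seq T :=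
  take i s ++ drop i.+1 s.

Section VerticalForms.
Context {R : realType} {n k : nat} {M : manifold R n} (F : foliation M k).
Implicit Types (u w : set M) (p : M) (q : nat).

(* The sections over [w] of the distribution. *)
Definition vsec w (X : vfield M) : Prop :=
  smooth_vfield w X /\ forall p, w p -> fol_dist F p (X p).

(* A [q]-form over [u] takes a point [p] of [u] and the list of its [q]
   arguments in the fibre at [p]. It is extended by zero to all other points and
   lists, so that equal forms over [u] are equal as functions. *)
Definition preform : Type := M -> seq (tvec M) -> R^o.
HB.instance Definition _ := GRing.Lmodule.on preform.

Definition vform u q : set preform := [set w : preform | [/\
  forall p s, ~ [/\ u p, size s = q & forall v, v \in s -> fol_dist F p v] ->
    w p s = 0,
  forall p s1 s2 (a : R) v v', u p -> fol_dist F p v -> fol_dist F p v' ->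
    w p (s1 ++ (a *: v + v') :: s2) =
    a *: w p (s1 ++ v :: s2) + w p (s1 ++ v' :: s2),
  forall p s1 s2 s3 v, w p (s1 ++ v :: s2 ++ v :: s3) = 0 &
  forall w' (Xs : seq (vfield M)), open w' -> w' `<=` u ->
    (forall X, X \in Xs -> vsec w' X) ->
    smooth_on w' (fun p => w p [seq X p | X <- Xs])]].

Definition restr w (o : preform) : preform :=
  fun p s => if `[< w p >] then o p s else 0.

(* The value at [p] of the formula defining [d_F o] on the fields [Xs], which
   are numbered from 0. *)
Definition cartan (o : preform) (Xs : seq (vfield M)) (p : M) : R^o :=
  \sum_(i < size Xs)
     (-1) ^+ i *: Xs`_i p (fun x => o x [seq X x | X <- del i Xs]) +
  \sum_(j < size Xs) \sum_(i < j)
     (-1) ^+ (i + j) *: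
       o p [seq X p | X <- bracket Xs`_i Xs`_j :: del i (del j Xs)].

(* A section near [p] of the distribution with the value [v] at [p]. *)
Definition extend (p : M) (v : tvec M) : vfield M :=
  xget 0 [set X | X p = v /\ exists w, [/\ open w, w p & vsec w X]].

(* For a form [o] over [u], the value of [cartan o] at [p] depends only on the
   values of the fields at [p], so the choice of the extensions is immaterial. *)
Definition dF u (o : preform) : preform := fun p s =>
  if `[< u p /\ forall v, v \in s -> fol_dist F p v >]
  then cartan o [seq extend p v | v <- s] p else 0.

Lemma fol_dist0 p : fol_dist F p 0.
Proof.
have [w [X [_ wp _ /(_ p wp)[-> _]]]] := fol_frame F p.
by exists (fun=> 0); rewrite big1 // => i _; rewrite scale0r.
Qed.

Lemma vsecS w w' X : w' `<=` w -> vsec w X -> vsec w' X.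
Proof.
by move=> ww' [sX VX]; split; [exact: smooth_vfieldS sX | move=> p /ww' /VX].
Qed.

Lemma vsec0 w : vsec w 0.
Proof.
split; last by move=> p _; exact: fol_dist0.
by split=> [p _|w' f _ _ _]; [exact: tangent0 | exact: smooth_on0].
Qed.

Lemma extend_vsec p v : exists w, [/\ open w, w p & vsec w (extend p v)].
Proof.
rewrite /extend; set P := (X in xget 0 X).
have [|nP] := pselect (exists X, P X); first by move/(xgetPex 0) => [_].
rewrite xgetPN; last by move=> X PX; apply: nP; exists X.
by exists setT; split=> [||]; [exact: openT | by [] | exact: vsec0].
Qed.

Lemma extend_vsecs u p (s : seq (tvec M)) : open u -> u p ->
  exists w, [/\ open w, w p, w `<=` u &
    forall X, X \in [seq extend p v | v <- s] -> vsec w X].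
Proof.
move=> ou up; elim: s => [|v s [w [ow wp wu Hw]]]; first by exists u; split.
have [w' [ow' wp' Hv]] := extend_vsec p v.
exists (w `&` w'); split=> //; [exact: openI | by move=> x [/wu]|].
move=> X; rewrite inE => /orP[/eqP->|/Hw]; first by apply: vsecS Hv => x [].
by apply: vsecS => x [].
Qed.

Lemma vform0 u q : vform u q 0.
Proof.
split=> //; first by move=> *; rewrite [RHS]addr0 [RHS]scaler0.
by move=> *; exact: smooth_on0.
Qed.

Lemma vform_lin u q (a : R) (o o' : preform) :
  vform u q o -> vform u q o' -> vform u q (a *: o + o').
Proof.
move=> [h1 h2 h3 h4] [p1 p2 p3 p4]; split.
- move=> p s H; change (a *: o p s + o' p s = 0).
  by rewrite h1 // p1 // scaler0 addr0.
- move=> p s1 s2 b v v' up Vv Vv'.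
  change (a *: o p (s1 ++ (b *: v + v') :: s2) +
          o' p (s1 ++ (b *: v + v') :: s2) =
    b *: (a *: o p (s1 ++ v :: s2) + o' p (s1 ++ v :: s2)) +
    (a *: o p (s1 ++ v' :: s2) + o' p (s1 ++ v' :: s2))).
  rewrite h2 // p2 // !scalerDr !scalerA (mulrC a b) -!addrA; congr (_ + _).
  by rewrite addrCA.
- move=> p s1 s2 s3 v.
  change (a *: o p (s1 ++ v :: s2 ++ v :: s3) +
    o' p (s1 ++ v :: s2 ++ v :: s3) = 0).
  by rewrite h3 p3 scaler0 addr0.
- move=> w Xs ow wu HX; apply: smooth_on_lin => //; [exact: h4|exact: p4].
Qed.

Lemma mem_del (T : eqType) i (s : seq T) : {subset del i s <= s}.
Proof. by move=> x; rewrite mem_cat => /orP[/mem_take|/mem_drop]. Qed.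

Lemma cartan_lin u q (a : R) (o o' : preform) w p Xs :
  vform u q o -> vform u q o' -> open w -> w p -> w `<=` u ->
  (forall X, X \in Xs -> vsec w X) ->
  cartan (a *: o + o') Xs p = a *: cartan o Xs p + cartan o' Xs p.
Proof.
move=> [_ _ _ h4] [_ _ _ p4] ow wp wu HX; rewrite /cartan.
rewrite scalerDr addrACA; congr (_ + _).
  rewrite scaler_sumr -big_split /=; apply: eq_bigr => i _.
  rewrite scalerA (mulrC a) -scalerA -scalerDr; congr (_ *: _).
  have [[/(_ p wp)[_ _ H _] _] _] := HX _ (mem_nth 0 (ltn_ord i)).
  have D X : X \in del i Xs -> vsec w X by move/mem_del/HX.
  by apply: H; exists w; split=> //; [exact: h4 | exact: p4].
rewrite scaler_sumr -big_split /=; apply: eq_bigr => j _.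
rewrite scaler_sumr -big_split /=; apply: eq_bigr => i _.
have E L : (a *: o + o') p L = a *: o p L + o' p L by [].
by rewrite E scalerDr !scalerA mulrC.
Qed.

Lemma dF_lin u q (a : R) (o o' : preform) : open u ->
  vform u q o -> vform u q o' ->
  dF u (a *: o + o') = a *: dF u o + dF u o'.
Proof.
move=> ou Ho Ho'; apply/funext=> p; apply/funext=> s.
change (dF u (a *: o + o') p s = a *: dF u o p s + dF u o' p s).
rewrite /dF; case: asboolP => [[up _]|_]; last by rewrite scaler0 addr0.
have [w [ow wp wu HX]] := extend_vsecs s ou up.
exact: cartan_lin Ho Ho' ow wp wu HX.
Qed.

Lemma restr_lin w (a : R) (o o' : preform) :
  restr w (a *: o + o') = a *: restr w o + restr w o'.
Proof.
apply/funext=> p; apply/funext=> s.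
change (restr w (a *: o + o') p s = a *: restr w o p s + restr w o' p s).
by rewrite /restr; case: asboolP => // _; rewrite scaler0 addr0.
Qed.

End VerticalForms.
Arguments preform {R n} M.

(* The cochains of degree [m] are the elements of the subspace [cx_mem m] of
   [cx_sort m]. That the differential preserves cochains and has square zero
   is not needed for defining the quotient of the space of cocycles by its
   subspace of coboundaries. *)
Record complex (R : nzRingType) := Complex {
  cx_sort : nat -> lmodType R;
  cx_mem : forall m, set (cx_sort m);
  cx_d : forall m, cx_sort m -> cx_sort m.+1;
  cx_mem0 : forall m, cx_mem (0 : cx_sort m);
  cx_mem_lin : forall m a (x y : cx_sort m),
    cx_mem x -> cx_mem y -> cx_mem (a *: x + y);
  cx_d_lin : forall m a (x y : cx_sort m), cx_mem x -> cx_mem y ->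
    cx_d (a *: x + y) = a *: cx_d x + cx_d y
}.

Section Cohomology.
Context {R : nzRingType} (K : complex R) (m : nat).

Definition is_cocycle : {pred cx_sort K m} :=
  fun x => `[< cx_mem x /\ cx_d x = 0 >].

Lemma is_cocycle_submod : submod_closed is_cocycle.
Proof.
have d0 : cx_d (0 : cx_sort K m) = 0.
  have := cx_d_lin 1 (@cx_mem0 _ K m) (@cx_mem0 _ K m).
  by rewrite !scale1r addr0 => /eqP; rewrite addrC -subr_eq subrr => /eqP.
split; first by apply/asboolP; split=> //; exact: cx_mem0.
move=> a x y /asboolP[Kx dx] /asboolP[Ky dy]; apply/asboolP; split.
  exact: cx_mem_lin.
by rewrite cx_d_lin // dx dy scaler0 addr0.
Qed.
HB.instance Definition _ :=
  GRing.isSubmodClosed.Build R (cx_sort K m) is_cocycle is_cocycle_submod.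

Record cocycle := Cocycle {
  cocycle_val :> cx_sort K m;
  _ : cocycle_val \in is_cocycle
}.
HB.instance Definition _ := [isSub for cocycle_val].
HB.instance Definition _ := [Choice of cocycle by <:].
HB.instance Definition _ := [SubChoice_isSubLmodule of cocycle by <:].

End Cohomology.

Definition coboundaries (R : nzRingType) (K : complex R) (m : nat) :
    set (cx_sort K m) :=
  match m with
  | 0 => [set 0]
  | m'.+1 => @cx_d _ K m' @` @cx_mem _ K m'
  end.

Section CohomologyQuotient.
Context {R : nzRingType} (K : complex R) (m : nat).

Definition is_coboundary : {pred cocycle K m} :=
  fun z => `[< coboundaries (val z) >].

Lemma is_coboundary_submod : submod_closed is_coboundary.
Proof.
have B0 : coboundaries (0 : cx_sort K m).
  case: m => [//|m'] /=; exists 0; first exact: cx_mem0.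
  have := cx_d_lin 1 (@cx_mem0 _ K m') (@cx_mem0 _ K m').
  by rewrite !scale1r addr0 => /eqP; rewrite addrC -subr_eq subrr => /eqP.
have BL a (x y : cx_sort K m) : coboundaries x -> coboundaries y ->
    coboundaries (a *: x + y).
  case: m x y => [|m'] x y /=; first by move=> -> ->; rewrite scaler0 addr0.
  move=> [x' Kx <-] [y' Ky <-]; exists (a *: x' + y'); first exact: cx_mem_lin.
  exact: cx_d_lin.
split; first by apply/asboolP; rewrite raddf0.
move=> a x y /asboolP Bx /asboolP By; apply/asboolP.
by rewrite linearP; exact: BL.
Qed.
HB.instance Definition _ :=
  GRing.isSubmodClosed.Build R (cocycle K m) is_coboundary is_coboundary_submod.

Definition cohomology : Type := {ideal_quot is_coboundary}.
HB.instance Definition _ := GRing.Zmodule.on cohomology.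

Definition coh_class (z : cocycle K m) : cohomology :=
  \pi_{ideal_quot is_coboundary} z.

Definition coh_repr (x : cohomology) : cocycle K m :=
  repr (x : {ideal_quot is_coboundary}).

Lemma coh_reprK : cancel coh_repr coh_class.
Proof. exact: reprK. Qed.

Lemma coh_classE z z' :
  (coh_class z == coh_class z') = (z - z' \in is_coboundary).
Proof. by rewrite Quotient.idealrBE. Qed.

Lemma coh_classD : {morph coh_class : x y / x + y}.
Proof. exact: Quotient.pi_add. Qed.

Definition coh_scale (a : R) (x : cohomology) : cohomology :=
  coh_class (a *: coh_repr x).

Lemma coh_classZ a z : coh_scale a (coh_class z) = coh_class (a *: z).
Proof.
apply/eqP; rewrite coh_classE -scalerBr rpredZ //.
by rewrite -coh_classE coh_reprK.
Qed.

Lemma coh_scaleA a b x : coh_scale a (coh_scale b x) = coh_scale (a * b) x.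
Proof. by rewrite -[x]coh_reprK !coh_classZ scalerA. Qed.

Lemma coh_scale1 : left_id 1 coh_scale.
Proof. by move=> x; rewrite -[x]coh_reprK coh_classZ scale1r. Qed.

Lemma coh_scaleDr : right_distributive coh_scale +%R.
Proof.
move=> a x y; rewrite -[x]coh_reprK -[y]coh_reprK.
by rewrite -coh_classD !coh_classZ scalerDr coh_classD.
Qed.

Lemma coh_scaleDl x : {morph coh_scale^~ x : a b / a + b}.
Proof.
by move=> a b; rewrite -[x]coh_reprK !coh_classZ scalerDl coh_classD.
Qed.

HB.instance Definition _ := GRing.Zmodule_isLmodule.Build R cohomology
  coh_scaleA coh_scale1 coh_scaleDr coh_scaleDl.

End CohomologyQuotient.

Section DoubleComplex.
Context {R : realType} {n k : nat} {M : manifold R n} (F : foliation M k).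

Definition vertical_complex : complex R :=
  @Complex R (fun=> preform M) (vform F setT) (fun=> dF F setT)
    (vform0 F setT) (fun q a x y => @vform_lin _ _ _ _ F setT q a x y)
    (fun q a x y => @dF_lin _ _ _ _ F setT q a x y openT).

Definition vertical_cohomology q := cohomology vertical_complex q.

Context {d : Order.disp_t} {A : orderType d} (U : A -> set M).

(* A [p]-cochain assigns a form to each increasing list of [p + 1] indices; it is
   extended by zero to all other lists. *)
Definition cech_cochain : Type := seq A -> preform M.
HB.instance Definition _ := GRing.Lmodule.on cech_cochain.

Definition cover_inter (s : seq A) : set M := \bigcap_(a in [set` s]) U a.

Definition double_mem (p q : nat) : set cech_cochain :=
  [set x : cech_cochain | forall s,
    if (size s == p.+1) && sorted <%O s
    then vform F (cover_inter s) q (x s) else x s = 0].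

Definition cech_delta (x : cech_cochain) : cech_cochain := fun s =>
  if sorted <%O s
  then \sum_(i < size s) (-1) ^+ i *: restr (cover_inter s) (x (del i s))
  else 0.

Definition cech_dF (x : cech_cochain) : cech_cochain :=
  fun s => dF F (cover_inter s) (x s).

(* The cochains of total degree [m] are the families [x] with [x p q] in the
   term of bidegree [(p, q)] if [p + q = m], and [x p q = 0] otherwise. *)
Definition total_cochain : Type := nat -> nat -> cech_cochain.
HB.instance Definition _ := GRing.Lmodule.on total_cochain.

Definition total_mem (m : nat) : set total_cochain :=
  [set x : total_cochain | forall p q,
    if (p + q == m)%N then double_mem p q (x p q) else x p q = 0].

Definition total_D (x : total_cochain) : total_cochain := fun p q =>
  (if p is p'.+1 then cech_delta (x p' q) else 0) +
  (-1) ^+ p *: (if q is q'.+1 then cech_dF (x p q') else 0).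

Definition restriction (m : nat) (o : preform M) : total_cochain :=
  fun p q s => if [&& p == 0, q == m & size s == 1]%N
    then restr (cover_inter s) o else 0.

Hypothesis Uopen : forall a, open (U a).

Lemma cover_inter_open s : open (cover_inter s).
Proof.
elim: s => [|a s IH].
  by rewrite (_ : cover_inter [::] = setT) ?predeqE; [exact: openT|].
rewrite (_ : cover_inter _ = U a `&` cover_inter s); first exact: openI.
apply/seteqP; split=> [p H|p [Ua H] b /=].
  by split=> [|b sb]; apply: H; rewrite /= inE ?eqxx ?sb ?orbT.
by rewrite inE => /orP[/eqP->//|]; exact: H.
Qed.

Lemma double_mem0 p q : double_mem p q 0.
Proof. by move=> s; case: ifP => // _; exact: vform0. Qed.

Lemma double_mem_lin p q (a : R) x y :
  double_mem p q x -> double_mem p q y -> double_mem p q (a *: x + y).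
Proof.
move=> Kx Ky s; move: (Kx s) (Ky s); case: ifP => _.
  exact: vform_lin.
by move=> x0 y0; change (a *: x s + y s = 0); rewrite x0 y0 scaler0 addr0.
Qed.

Lemma double_mem_vform p q x s : double_mem p q x ->
  vform F (cover_inter s) q (x s).
Proof. by move/(_ s); case: ifP => // _ ->; exact: vform0. Qed.

Lemma cech_delta_lin (a : R) x y :
  cech_delta (a *: x + y) = a *: cech_delta x + cech_delta y.
Proof.
apply/funext => s.
change (cech_delta (a *: x + y) s = a *: cech_delta x s + cech_delta y s).
rewrite /cech_delta; case: ifP => _; last by rewrite scaler0 addr0.
rewrite scaler_sumr -big_split /=; apply: eq_bigr => i _.
by rewrite restr_lin scalerDr !scalerA mulrC.
Qed.

Lemma cech_dF_lin p q (a : R) x y : double_mem p q x -> double_mem p q y ->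
  cech_dF (a *: x + y) = a *: cech_dF x + cech_dF y.
Proof.
move=> Kx Ky; apply/funext => s.
apply: (@dF_lin _ _ _ _ F (cover_inter s) q) (cover_inter_open s) _ _.
  exact: double_mem_vform Kx.
exact: double_mem_vform Ky.
Qed.

Lemma total_mem0 m : total_mem m 0.
Proof. by move=> p q; case: ifP => // _; exact: double_mem0. Qed.

Lemma total_mem_lin m (a : R) x y :
  total_mem m x -> total_mem m y -> total_mem m (a *: x + y).
Proof.
move=> Kx Ky p q; move: (Kx p q) (Ky p q); case: ifP => _.
  exact: double_mem_lin.
move=> x0 y0; change (a *: x p q + y p q = 0).
by rewrite x0 y0 scaler0 addr0.
Qed.

Lemma total_D_lin m (a : R) x y : total_mem m x -> total_mem m y ->
  total_D (a *: x + y) = a *: total_D x + total_D y.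
Proof.
move=> Kx Ky; apply/funext => p; apply/funext => q.
change (total_D (a *: x + y) p q = a *: total_D x p q + total_D y p q).
rewrite /total_D scalerDr addrACA; congr (_ + _).
  by case: p => [|p]; [rewrite scaler0 addr0 | exact: cech_delta_lin].
case: q => [|q]; first by rewrite !scaler0 addr0.
have D z : total_mem m z -> double_mem p q (z p q).
  by move=> /(_ p q); case: ifP => // _ ->; exact: double_mem0.
have E := cech_dF_lin a (D _ Kx) (D _ Ky).
by rewrite [X in _ *: X]E scalerDr !scalerA mulrC.
Qed.

Definition total_complex : complex R :=
  @Complex R (fun=> total_cochain) total_mem (fun=> total_D)
    total_mem0 total_mem_lin total_D_lin.

Definition total_cohomology m := cohomology total_complex m.

End DoubleComplex.

(* Main.v *)
From HB Require Import structures.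
Require Import Defs.
From mathcomp Require Import all_boot all_order all_algebra.
From mathcomp Require Import all_classical all_reals all_analysis.
From mathcomp Require Import ring lra zify.
Import Order.TTheory GRing.Theory Num.Theory.
Import numFieldNormedType.Exports.
Set Implicit Arguments.
Unset Strict Implicit.
Unset Printing Implicit Defensive.
Local Open Scope classical_set_scope.
Local Open Scope ring_scope.

(** The rows of the double complex, augmented by the forms on [M], are exact. The
    total complex of a double complex with exact augmented rows has the
    cohomology of the augmentation: a total cochain whose differential vanishes
    outside the column [p = 0] can be pushed into that column, one column at a
    time, by subtracting differentials ([staircase]), and what remains there is
    the restriction of a global form ([column_restriction]). Applied to cocycles,
    this makes the map induced by restriction surjective; applied to cochains
    whose differential is a restriction, it makes it injective.

    Exactness of the rows ([row_exact]) combines two facts. Over [U a], coning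
    off from the index [a] contracts the simplicial cochains ([cone_homotopy]),
    so that a Cech cocycle is there the coboundary of its cone. These local
    primitives are averaged by a smooth partition of unity subordinate to the
    covering; the Cech coboundary is linear over functions, so no derivative of
    the partition appears. The partition ([partition_of_unity]) rests on bump
    functions in charts and on second countability.

    The vertical differential is defined pointwise, by Cartan's formula applied to
    arbitrary extensions of the arguments. That it maps forms to forms, squares to
    zero and commutes with restriction is obtained from a calculus on cochains of
    the Lie algebra of vertical fields: the differential is rewritten by recursion
    on [i_X d = L_X - d i_X] ([CE], [cartan_CE]), after which [L_X d = d L_X],
    [d d = 0], alternation and linearity over functions are inductions on the list
    of fields ([Lie_CE], [CE_CE], [CE_alt_adj], [CE_tensor]). Linearity over
    functions, together with the smoothness of the coefficients of a vertical
    field in a local frame ([frame_coeff]), shows that the value at a point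
    depends only on the values of the fields there ([CE_pointwise]). *)

(** * Smooth functions on Euclidean space *)

Section Calculus.
Context {R : realType} {n : nat}.
Implicit Types (O : set 'rV[R]_n) (f g : 'rV[R]_n -> R).

Lemma Ck_cont j O f x : Ck j O f -> O x -> {for x, continuous f}.
Proof. by case: j => [|j] [cf _]; exact: cf. Qed.

Lemma Ck_pred j O f : Ck j.+1 O f -> Ck j O f.
Proof.
elim: j f => [|j IH] f [cf Hf]; first by split.
by split=> // i; have [df Cf] := Hf i; split=> //; exact: IH.
Qed.

Lemma Ck_local j O f :
  (forall x, O x -> exists2 W, W x & Ck j W f) -> Ck j O f.
Proof.
elim: j f => [|j IH] f Hf.
  by split=> // x /Hf [W Wx Cf]; exact: Ck_cont Cf Wx.
split=> [x /Hf [W Wx Cf]|i]; first exact: Ck_cont Cf Wx.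
split=> [x Ox|].
  by have [W Wx [_ /(_ i)[df _]]] := Hf x Ox; exact: df.
by apply: IH => x /Hf [W Wx [_ /(_ i)[_ Cf]]]; exists W.
Qed.

Lemma Ck_add j O f g : open O -> Ck j O f -> Ck j O g ->
  Ck j O (fun x => f x + g x).
Proof.
move=> oO Cf Cg; apply: (Ck_ext _ _ (Ck_lin 1 oO Cf Cg)) => // x _.
by rewrite mul1r.
Qed.

Lemma Ck_mul j O f g : open O -> Ck j O f -> Ck j O g ->
  Ck j O (fun x => f x * g x).
Proof.
move=> oO; elim: j f g => [|j IH] f g Cf Cg.
all: have c x : O x -> {for x, continuous (fun x => f x * g x)}
  by move=> Ox; apply: continuousM; [exact: Ck_cont Cf Ox|exact: Ck_cont Cg Ox].
  by split.
split=> // i; have [_ /(_ i) [df Df]] := Cf; have [_ /(_ i) [dg Dg]] := Cg.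
split=> [x Ox|]; first by apply: derivableM; [exact: df|exact: dg].
have C1 := IH _ _ (Ck_pred Cf) Dg; have C2 := IH _ _ (Ck_pred Cg) Df.
apply: (Ck_ext _ _ (Ck_add oO C1 C2)) => // x Ox.
by rewrite -[RHS]/('D_(delta_mx ord0 i) ((f : _ -> R^o) * g) x) deriveM//;
  [exact: df|exact: dg].
Qed.

Lemma Ck_inv j O f : open O -> (forall x, O x -> f x != 0) -> Ck j O f ->
  Ck j O (fun x => (f x)^-1).
Proof.
move=> oO f0; elim: j => [|j IH] Cf.
all: have c x : O x -> {for x, continuous (fun x => (f x)^-1)}
  by move=> Ox; apply: continuousV; [exact: f0|exact: Ck_cont Cf Ox].
  by split.
split=> // i; have [_ /(_ i) [df Df]] := Cf; have C1 := IH (Ck_pred Cf).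
split=> [x Ox|]; first by apply: derivableV; [exact: f0|exact: df].
have C2 := Ck_mul oO (Ck_cst j O (-1)) (Ck_mul oO (Ck_mul oO C1 C1) Df).
apply: Ck_ext C2 => // x Ox.
by rewrite deriveV ?f0//; [rewrite mulrA mulN1r -invfM -expr2|exact: df].
Qed.

(** Along the line through [x] directed by [v] this is the chain rule for real
    functions of one variable. *)
Lemma is_derive_comp1 (h : R -> R) f (x v : 'rV[R]_n) a :
  derivable f x v -> is_derive (f x) 1 h a ->
  is_derive x v (fun y => h (f y)) (a * 'D_v f x).
Proof.
move=> df dh; have df1 := (derivable1P _ _ _).1 df.
have E (F : 'rV[R]_n -> R) : 'D_v F x = 'D_1 (fun t : R => F (t *: v + x)) 0.
  rewrite /derive; set g1 := fun h => h^-1 *: _; set g2 := fun h => h^-1 *: _.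
  suff -> : g1 = g2 by [].
  by apply/funext => t; rewrite /g1 /g2 /= addr0 scale0r add0r [_%:A]mulr1.
have dh' : is_derive (f (0 *: v + x)) 1 h a by rewrite scale0r add0r.
have := @is_derive1_comp _ h _ _ _ _ dh' (derivableP df1).
move=> [d1 d2]; split; first exact/derivable1P.
by rewrite !E -d2.
Qed.

(** The family [t ^- m * exp (- 1 / t)], extended by 0, has derivatives in its own
    linear span, which is why smoothness of all its members is a single
    induction. *)
Definition flat (m : nat) (t : R) : R :=
  if 0 < t then t^-1 ^+ m * expR (- t^-1) else 0.

(** The term of degree [m + 1] of the exponential series at [1 / t] is at most
    [exp (1 / t)]. *)
Lemma flat_bound m (t : R) : 0 < t -> flat m t <= (m.+1)`!%:R * t.
Proof.
move=> t0; rewrite /flat t0; set s := t^-1.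
have s0 : 0 < s by rewrite invr_gt0.
have f0 : 0 < (m.+1)`!%:R :> R by rewrite ltr0n fact_gt0.
have H : s ^+ m.+1 / m.+1`!%:R <= expR s.
  by apply: le_trans (expR_ge1Dxn m (ltW s0)); rewrite lerDr.
rewrite expRN ler_pdivrMr ?expR_gt0// -ler_pdivrMl ?mulr_gt0//.
apply: le_trans H; rewrite exprS invfM -/s.
by rewrite mulrC mulrA [s * _]mulrC mulrAC [_ * s]mulrC.
Qed.

Lemma flat_ge0 m t : 0 <= flat m t.
Proof.
rewrite /flat; case: ifP => // t0.
by rewrite mulr_ge0 ?exprn_ge0 ?invr_ge0 ?expR_ge0 ?(ltW t0).
Qed.

Lemma flat_gt0 m t : 0 < t -> 0 < flat m t.
Proof.
by move=> t0; rewrite /flat t0 mulr_gt0 ?exprn_gt0 ?invr_gt0 ?expR_gt0.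
Qed.

Lemma flat_le0 m t : t <= 0 -> flat m t = 0.
Proof. by rewrite /flat leNgt; case: ifP. Qed.

Lemma flat_derive m (t : R) :
  is_derive t 1 (flat m) (- m%:R * flat m.+1 t + flat m.+2 t).
Proof.
have [t0|t0|->] := ltgtP t 0.
- rewrite !flat_le0 ?ltW// mulr0 addr0.
  apply: (@near_eq_is_derive _ _ _ (cst 0)).
  near=> u; rewrite /= flat_le0//; apply: ltW.
  by near: u; apply: open_nbhs_nbhs; split=> //; exact: open_lt.
- apply: (@near_eq_is_derive _ _ _ (fun u : R => u^-1 ^+ m * expR (- u^-1))).
    near=> u; rewrite /flat; case: ifPn => //.
    move=> /negP; case.
    by near: u; apply: open_nbhs_nbhs; split=> //; exact: open_gt.
  have d1 : is_derive t 1 (fun u : R => u^-1) (- t ^- 2).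
    have := @is_deriveV _ id t 1 1 (lt0r_neq0 t0) (is_derive_id _ _).
    by rewrite [_ *: 1]mulr1.
  have d2 : is_derive t 1 (fun u : R => expR (- u^-1)) (expR (- t^-1) * t ^- 2).
    apply: (@is_derive1_comp _ expR (fun u => - u^-1)).
    by rewrite -[t ^- 2]opprK; exact: is_deriveN.
  have d3 : is_derive t 1 (fun u : R => u^-1 ^+ m)
      (m%:R * t^-1 ^+ m.-1 * - t ^- 2).
    have -> : (fun u : R => u^-1 ^+ m) = (fun u : R => u^-1) ^+ m.
      by apply/funext => u; rewrite exprfctE.
    exact: is_deriveX.
  have [e1 e2] := @is_deriveM _ _ _ _ _ _ _ _ d3 d2.
  split; first exact: e1.
  rewrite [LHS]e2 /flat t0 /GRing.scale/=.
  rewrite -exprVn; case: m {d3 e1 e2} => [|m] /=; rewrite !exprS ?expr0; ring.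
(* At 0 the difference quotient is [flat m.+1 h], which [flat_bound] controls. *)
rewrite !flat_le0 // mulr0 addr0.
suff H : (fun h : R => h^-1 *: (flat m (h *: 1 + 0) - flat m 0)) @ 0^' --> (0 : R).
  split; first by apply/cvg_ex; exists 0.
  exact/cvg_lim.
apply/cvgr0Pnorm_le => e e0.
near=> h; rewrite addr0 [_%:A]mulr1 (flat_le0 _ (lexx 0)) subr0 /GRing.scale/=.
have [h0|h0] := ltP 0 h; last by rewrite flat_le0// mulr0 normr0 ltW.
have -> : h^-1 * flat m h = flat m.+1 h by rewrite /flat h0 exprS mulrA.
rewrite ger0_norm ?flat_ge0//; apply: le_trans (flat_bound _ h0) _.
have f0 : 0 < (m.+2)`!%:R :> R by rewrite ltr0n fact_gt0.
rewrite -ler_pdivlMl// -[h]gtr0_norm//.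
near: h; apply: dnbhs0_le.
by rewrite mulr_gt0// invr_gt0.
Unshelve. all: by end_near. Qed.

Lemma Ck_flat j m O f : open O -> Ck j O f -> Ck j O (fun x => flat m (f x)).
Proof.
move=> oO; elim: j m => [|j IH] m Cf.
all: have c x : O x -> {for x, continuous (fun x => flat m (f x))}
  by (move=> Ox; apply: continuous_comp; [exact: Ck_cont Cf Ox|];
     apply: differentiable_continuous; apply/derivable1_diffP;
     have [] := flat_derive m (f x)).
  by split.
split=> // i; have [_ /(_ i) [df Df]] := Cf.
have D x : O x -> is_derive x (delta_mx ord0 i) (fun y => flat m (f y))
   ((- m%:R * flat m.+1 (f x) + flat m.+2 (f x)) * 'D_(delta_mx ord0 i) f x).
  by move=> Ox; apply: is_derive_comp1; [exact: df|exact: flat_derive].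
split=> [x Ox|]; first by have [] := D x Ox.
have C1 := Ck_mul oO
  (Ck_lin (- m%:R) oO (IH m.+1 (Ck_pred Cf)) (IH m.+2 (Ck_pred Cf))) Df.
by apply: Ck_ext C1 => // x Ox; have [_ ->] := D x Ox.
Qed.

Lemma Ck_sum j O I (s : seq I) (f : I -> 'rV[R]_n -> R) : open O ->
  (forall i, Ck j O (f i)) -> Ck j O (fun x => \sum_(i <- s) f i x).
Proof.
move=> oO Cf; elim: s => [|i s IH].
  by apply: (Ck_ext oO _ (Ck_cst j O 0)) => x _; rewrite big_nil.
by apply: (Ck_ext oO _ (Ck_add oO (Cf i) IH)) => x _; rewrite big_cons.
Qed.

Lemma Ck_prod j O I (s : seq I) (f : I -> 'rV[R]_n -> R) : open O ->
  (forall i, Ck j O (f i)) -> Ck j O (fun x => \prod_(i <- s) f i x).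
Proof.
move=> oO Cf; elim: s => [|i s IH].
  by apply: (Ck_ext oO _ (Ck_cst j O 1)) => x _; rewrite big_nil.
by apply: (Ck_ext oO _ (Ck_mul oO (Cf i) IH)) => x _; rewrite big_cons.
Qed.

(** A smooth step: 1 up to 1, and 0 from 4 on. The thresholds are squared radii,
    in ratio 2, of concentric coordinate balls. *)
Definition cutoff (t : R) : R := flat 0 (4 - t) / (flat 0 (4 - t) + flat 0 (t - 1)).

Lemma cutoff_den t : flat 0 (4 - t) + flat 0 (t - 1) != 0.
Proof.
have [t1|t1] := ltP 1 t.
  by rewrite gt_eqF// ltr_wpDl ?flat_ge0 ?flat_gt0// subr_gt0.
by rewrite gt_eqF// ltr_wpDr ?flat_ge0 ?flat_gt0//; lra.
Qed.

Lemma cutoff1 t : t <= 1 -> cutoff t = 1.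
Proof.
move=> t1; have := cutoff_den t; rewrite /cutoff [flat 0 (t - 1)]flat_le0 ?subr_le0//.
by rewrite addr0 => /divff.
Qed.

Lemma cutoff0 t : 4 <= t -> cutoff t = 0.
Proof. by move=> t1; rewrite /cutoff flat_le0 ?mul0r// subr_le0. Qed.

Lemma Ck_cutoff j O f : open O -> Ck j O f -> Ck j O (fun x => cutoff (f x)).
Proof.
move=> oO Cf.
have C1 : Ck j O (fun x => flat 0 (4 - f x)).
  apply: Ck_flat => //; apply: (Ck_ext oO _ (Ck_lin (-1) oO Cf (Ck_cst j O 4))).
  by move=> x _; rewrite mulN1r addrC.
have C2 : Ck j O (fun x => flat 0 (f x - 1)).
  by apply: Ck_flat => //; exact: Ck_add oO Cf (Ck_cst j O (-1)).
apply: Ck_mul => //; apply: Ck_inv => //; last exact: Ck_add.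
by move=> x _; exact: cutoff_den.
Qed.

End Calculus.

(** * Smooth functions on a manifold *)

Section SmoothFunctions.
Context {R : realType} {n : nat} {M : manifold R n}.
Implicit Types (u w : set M) (p : M) (f g : M -> R^o).

Lemma smooth_on_cst w (a : R) : smooth_on w (fun=> a).
Proof. by move=> c Ac k; exact: Ck_cst. Qed.

Lemma smooth_on_add w f g : open w -> smooth_on w f -> smooth_on w g ->
  smooth_on w (fun x => f x + g x).
Proof.
move=> ow sf sg c Ac k; apply: Ck_add; first exact: chart_pre_open.
  exact: sf.
exact: sg.
Qed.

Lemma smooth_on_mul w f g : open w -> smooth_on w f -> smooth_on w g ->
  smooth_on w (fun x => f x * g x).
Proof.
move=> ow sf sg c Ac k; apply: Ck_mul; first exact: chart_pre_open.
  exact: sf.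
exact: sg.
Qed.

Lemma smooth_on_inv w f : open w -> (forall p, w p -> f p != 0) ->
  smooth_on w f -> smooth_on w (fun x => (f x)^-1).
Proof.
move=> ow f0 sf c Ac k; apply: Ck_inv; first exact: chart_pre_open.
  by move=> y [_ wy]; exact: f0.
exact: sf.
Qed.

Lemma smooth_on_sum w I (s : seq I) (f : I -> M -> R^o) : open w ->
  (forall i, smooth_on w (f i)) -> smooth_on w (fun x => \sum_(i <- s) f i x).
Proof.
move=> ow sf c Ac k.
apply: (@Ck_sum _ _ _ _ _ s (fun i y => f i (chart_inv c y))).
  exact: chart_pre_open.
by move=> i; exact: sf.
Qed.

Lemma smooth_on_prod w I (s : seq I) (f : I -> M -> R^o) : open w ->
  (forall i, smooth_on w (f i)) -> smooth_on w (fun x => \prod_(i <- s) f i x).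
Proof.
move=> ow sf c Ac k.
apply: (@Ck_prod _ _ _ _ _ s (fun i y => f i (chart_inv c y))).
  exact: chart_pre_open.
by move=> i; exact: sf.
Qed.

Lemma smooth_on_det w m (A : M -> 'M[R]_m) : open w ->
  (forall i j, smooth_on w (fun q => A q i j)) ->
  smooth_on w (fun q => \det (A q)).
Proof.
move=> ow sA; apply: smooth_on_sum => // s.
by apply: smooth_on_mul (smooth_on_cst _ _) _ => //; exact: smooth_on_prod.
Qed.

Lemma smooth_on_local w f :
  (forall p, w p -> exists2 w', w' p & smooth_on w' f) -> smooth_on w f.
Proof.
move=> H c Ac k; apply: Ck_local => y [cy /H[w' w'y sf]].
by exists (chart_img c `&` chart_inv c @^-1` w') => //; exact: sf.
Qed.

Lemma smooth_on_cont w f p : smooth_on w f -> w p -> {for p, continuous f}.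
Proof.
move=> sf wp; have [c Ac cp] := mfd_cover p.
have E : {near p, f \o chart_inv c \o chart_map c =1 f}.
  have oc := open_nbhs_nbhs (conj (chart_dom_open c) cp).
  by apply: filterS oc => q cq /=; rewrite chart_mapK.
have C : {for p, continuous ((f \o chart_inv c) \o chart_map c)}.
  apply: continuous_comp; first exact: chart_map_cont.
  apply: Ck_cont (sf c Ac 0%N) _; split; first by exists p.
  by rewrite /= chart_mapK.
rewrite /prop_for /continuous_at.
have <- : (f \o chart_inv c \o chart_map c) p = f p by rewrite /= chart_mapK.
exact: cvg_trans (near_eq_cvg E) C.
Qed.

Lemma smooth_on_neq0 w f : open w -> smooth_on w f ->
  open (w `&` [set p | f p != 0]).
Proof.
move=> ow sf; rewrite openE => p [wp fp]; apply: filterI.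
  exact: open_nbhs_nbhs.
apply: (smooth_on_cont sf wp (t := [set t | t != 0])).
by apply: open_nbhs_nbhs; split=> //; exact: open_neq.
Qed.

(** Compactness of the closed coordinate box, hence closedness of its image in
    the Hausdorff space [M], is what makes the extension by zero smooth. *)
Lemma bump_function p u : open u -> u p -> exists psi S w,
  [/\ smooth_on setT psi, closed S, S `<=` u,
      forall q, ~ S q -> psi q = 0 &
      [/\ open w, w p & forall q, w q -> psi q = 1]].
Proof.
move=> ou up; have [c Ac cp] := mfd_cover p.
set y0 := chart_map c p.
have Oy0 : (chart_img c `&` chart_inv c @^-1` u) y0.
  by split; [exists p | rewrite /= chart_mapK].
have [e /= e0 He] : exists2 e : R, 0 < e &
    ball y0 e `<=` chart_img c `&` chart_inv c @^-1` u.
  by apply/nbhs_ballP; apply: open_nbhs_nbhs; split=> //; exact: chart_pre_open.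
pose r := e / 2; have r0 : 0 < r by rewrite divr_gt0.
pose box : set 'rV[R]_n :=
  [set y | forall i, y ord0 i \in `[y0 ord0 i - r, y0 ord0 i + r]].
have boxO : box `<=` chart_img c `&` chart_inv c @^-1` u.
  move=> y By; apply: He; split=> // i j; rewrite (ord1 i).
  have := By j; rewrite in_itv /= => /andP[l1 l2].
  rewrite /ball /= ltr_norml; apply/andP; rewrite /r in l1 l2.
  by have := e0; split; lra.
pose S := chart_inv c @` box.
have cS : closed S.
  apply: compact_closed (@mfd_hausdorff _ _ M) _; apply: continuous_compact.
    apply: continuous_in_subspaceT => y; rewrite inE => /boxO [cy _].
    exact: chart_inv_cont.
  apply: (@rV_compact _ _ (fun i => `[y0 ord0 i - r, y0 ord0 i + r]%classic)).
  by move=> i; exact: segment_compact.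
(* Scaled so that [g] is at least 4 off the box, where [cutoff] has become 0. *)
pose g (y : 'rV[R]_n) : R := 4 * (r^-1 ^+ 2) * \sum_i (y ord0 i - y0 ord0 i) ^+ 2.
pose psi (q : M) : R^o :=
  if `[< chart_dom c q >] then cutoff (g (chart_map c q)) else 0.
have gbox y : ~ box y -> 4 <= g y.
  move=> nb; have [i ni] : exists i, ~~ (y ord0 i \in `[y0 ord0 i - r, y0 ord0 i + r]).
    by apply: contrapT => H; apply: nb => i; apply: contrapT => Hi;
      apply: H; exists i; apply/negP.
  have Hr : r ^+ 2 <= (y ord0 i - y0 ord0 i) ^+ 2.
    move: ni; rewrite in_itv /= negb_and -!ltNge.
    by have := r0 => ? /orP[] H; nra.
  rewrite /g -mulrA ler_pMr// -[1](@mulVf _ (r ^+ 2)) ?expf_neq0 ?gt_eqF//.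
  rewrite exprVn ler_pM2l ?invr_gt0 ?exprn_gt0//.
  apply: le_trans Hr _; rewrite (bigD1 i) //= lerDl.
  by apply: sumr_ge0 => j _; exact: sqr_ge0.
have psi0 q : ~ S q -> psi q = 0.
  move=> nS; rewrite /psi; case: asboolP => // cq; apply/cutoff0/gbox => B.
  by apply: nS; exists (chart_map c q) => //; rewrite chart_mapK.
have cutg j O (T : 'I_n -> 'rV[R]_n -> R) : open O -> (forall i, Ck j O (T i)) ->
    Ck j O (fun y => cutoff (4 * (r^-1 ^+ 2) * \sum_i (T i y - y0 ord0 i) ^+ 2)).
  move=> oO CT; apply: Ck_cutoff => //; apply: Ck_mul (Ck_cst _ _ _) _ => //.
  apply: Ck_sum => // i; rewrite /=.
  have C := Ck_add oO (CT i) (Ck_cst j O (- y0 ord0 i)).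
  by have := Ck_mul oO C C; apply: Ck_ext.
exists psi, S, (chart_dom c `&` [set q | g (chart_map c q) < 1]).
split=> //; first last.
- split; last 1 first.
  + by move=> q [cq gq]; rewrite /psi asboolT// cutoff1// ltW.
  + rewrite openE => q [cq gq]; apply: filterI.
      by apply: open_nbhs_nbhs; split=> //; exact: chart_dom_open.
    have cg : {for q, continuous (g \o chart_map c)}.
      apply: continuous_comp; first exact: chart_map_cont.
      have Cg : Ck 0 setT g.
        apply: Ck_mul (Ck_cst _ _ _) _ => //; first exact: openT.
        apply: Ck_sum => [|i]; first exact: openT.
        have C1 : Ck 0 setT (fun y : 'rV[R]_n => y ord0 i - y0 ord0 i).
          apply: Ck_add (Ck_cst _ _ _); first exact: openT.
          by split=> // y _; exact: coord_continuous.
        by have := Ck_mul openT C1 C1; apply: Ck_ext; first exact: openT.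
      exact: (Ck_cont Cg).
    by apply: (cg [set t | t < 1]); apply: open_nbhs_nbhs; split=> //; exact: open_lt.
  + split=> //=; rewrite /g big1 ?mulr0// => i _.
    by rewrite subrr expr0n.
- by move=> q [y /boxO [_ uy] <-].
move=> c' Ac' j; apply: Ck_local => y [c'y _].
have [cy|ncy] := pselect (chart_dom c (chart_inv c' y)); last first.
  exists (chart_img c' `&` chart_inv c' @^-1` (~` S)).
    split=> // -[z Bz Ez]; apply: ncy; rewrite -Ez.
    by have [[q cq <-] _] := boxO z Bz; rewrite chart_mapK.
  apply: (Ck_ext _ _ (Ck_cst _ _ 0)) => [|z [_ Sz]].
    by apply: chart_pre_open; exact: closed_openC.
  by rewrite /= psi0.
exists (chart_img c' `&` chart_inv c' @^-1` chart_dom c) => //.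
have oO := @chart_pre_open _ _ _ c' _ (chart_dom_open c).
have CT i : Ck j (chart_img c' `&` chart_inv c' @^-1` chart_dom c)
    (fun y => chart_map c (chart_inv c' y) ord0 i).
  apply: CkS (mfd_compat i Ac' Ac j) => z [[q c'q <-]] /=.
  by rewrite chart_mapK// => cq; exists q.
by apply: (Ck_ext oO _ (cutg _ _ _ oO CT)) => z [_ cz]; rewrite /= /psi asboolT.
Qed.

End SmoothFunctions.

(** * Partitions of unity *)

Section Partition.
Context {R : realType} {n : nat} {M : manifold R n}.
Implicit Types (u w : set M) (p : M) (f g : M -> R^o).

(** Each [phi i] is [psi i * \prod_(j < i) (1 - psi j)] for bump functions [psi]
    equal to 1 on the members of a countable base. As soon as [psi j = 1] near a
    point, all later products vanish there, so no locally finite refinement of the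
    covering is required; the partial sums telescope to [1 - \prod_j (1 - psi j)]. *)
Lemma partition_of_unity (A : choiceType) (a0 : A) (U : A -> set M) :
  (forall a, open (U a)) -> \bigcup_a U a = [set: M] ->
  exists (phi : nat -> M -> R^o) (al : nat -> A) (S : nat -> set M),
  [/\ forall i, smooth_on setT (phi i),
      forall i, closed (S i),
      forall i, S i `<=` U (al i),
      forall i q, ~ S i q -> phi i q = 0 &
      forall p, exists N w, [/\ open w, w p & forall q, w q ->
        (forall i, (N <= i)%N -> phi i q = 0) /\ \sum_(i < N) phi i q = 1]].
Proof.
move=> oU cU.
have [B /countable_injP[e einj] [Bo Bb]] := @mfd_second_countable _ _ M.
pose good (V : set M) (x : (M -> R^o) * A * set M) :=
  [/\ smooth_on setT x.1.1, closed x.2, x.2 `<=` U x.1.2,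
    forall q, ~ x.2 q -> x.1.1 q = 0 & forall q, V q -> x.1.1 q = 1].
pose V i := xget set0 [set V | B V /\ e V = i].
(* Base sets on which no such function is 1 get the zero function; every point lies
   in a base set of the other kind. *)
pose x i := xget ((fun=> 0) : M -> R^o, a0, set0) (good (V i)).
have Hx i : [/\ smooth_on setT (x i).1.1, closed (x i).2, (x i).2 `<=` U (x i).1.2 &
    forall q, ~ (x i).2 q -> (x i).1.1 q = 0].
  rewrite /x; case: xgetP => [y -> [] //|_]; split=> //=.
  + exact: smooth_on_cst.
  + exact: closed0.
have cov p : exists i w, [/\ open w, w p & forall q, w q -> (x i).1.1 q = 1].
  have [a _ Uap] : (\bigcup_a U a) p by rewrite cU.
  have [psi [S [w [sp cS SU p0 [ow wp p1]]]]] := bump_function (oU a) Uap.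
  have [W [BW Wp] Ww] := Bb p w (open_nbhs_nbhs (conj ow wp)).
  exists (e W), W; split=> //; first exact: Bo.
  have VW : V (e W) = W.
    rewrite /V; case: xgetP => [y -> [By ey]|/(_ W)/=]; last by case.
    by apply: einj => //; rewrite inE.
  rewrite /x; case: xgetP => [y -> [_ _ _ _]|]; first by rewrite VW.
  by move=> /(_ (psi, a, S)); case; rewrite VW; split=> // q /Ww; exact: p1.
pose psi i : M -> R^o := (x i).1.1.
pose phi i : M -> R^o := fun q => psi i q * \prod_(j < i) (1 - psi j q).
have sum_phi N q : \sum_(i < N) phi i q = 1 - \prod_(j < N) (1 - psi j q).
  elim: N => [|N IH]; first by rewrite !big_ord0 subrr.
  by rewrite !big_ord_recr /= IH /phi; ring.
exists phi, (fun i => (x i).1.2), (fun i => (x i).2); split.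
- move=> i; apply: smooth_on_mul; first exact: openT.
    by have [] := Hx i.
  apply: (@smooth_on_prod _ _ _ _ _ _ (fun (j : 'I_i) q => 1 - psi j q)).
    exact: openT.
  move=> j; have [sj _ _ _] := Hx j.
  have := smooth_on_lin (-1) openT sj (@smooth_on_cst _ _ M setT 1).
  apply: smooth_on_ext; first exact: openT.
  by move=> q _; rewrite -[LHS]/(-1 * psi j q + 1) mulN1r addrC.
- by move=> i; have [] := Hx i.
- by move=> i; have [] := Hx i.
- by move=> i q Sq; rewrite /phi /psi; have [_ _ _ ->] := Hx i; rewrite ?mul0r.
move=> p; have [i [w [ow wp w1]]] := cov p.
exists i.+1, w; split=> // q wq.
have z j : (i < j)%N -> \prod_(j0 < j) (1 - psi j0 q) = 0.
  move=> ij; rewrite (bigD1 (Ordinal ij)) //=.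
  by rewrite /psi w1// subrr mul0r.
split=> [j ij|]; first by rewrite /phi z// mulr0.
by rewrite sum_phi z// subr0.
Qed.

End Partition.

(** * Tangent vectors and brackets *)

Section Fields.
Context {R : realType} {n : nat} {M : manifold R n}.
Implicit Types (u w : set M) (p : M) (f g : M -> R^o) (X Y Z : vfield M).

Lemma smooth_at_on w p f : open w -> w p -> smooth_on w f -> smooth_at p f.
Proof. by exists w; split. Qed.

Lemma open_nbhsE p (P : set M) : (\forall x \near p, P x) ->
  exists V, [/\ open V, V p & forall x, V x -> P x].
Proof.
move=> H; have {H} : nbhs p P := H.
by rewrite nbhsE => -[V [oV Vp] VP]; exists V; split.
Qed.

Lemma near_open p w (P : M -> Prop) : open w -> w p ->
  (forall x, w x -> P x) -> \forall x \near p, P x.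
Proof. by move=> ow wp wP; apply: (filterS wP); exact: open_nbhs_nbhs. Qed.

Lemma smooth_at_ext p f g : (\forall x \near p, f x = g x) ->
  smooth_at p f -> smooth_at p g.
Proof.
move=> /open_nbhsE[V [oV Vp Vfg]] [w [ow wp sf]].
exists (w `&` V); split=> //; first exact: openI.
apply: (@smooth_on_ext _ _ _ _ f); first exact: openI.
  by move=> q [_ /Vfg].
by apply: smooth_onS sf => q [].
Qed.

Lemma smooth_at_nbhs p f : smooth_at p f -> \forall q \near p, smooth_at q f.
Proof.
by move=> [w [ow wp sf]]; apply: (near_open ow wp) => q wq; exists w; split.
Qed.

Lemma smooth_at2 p f g : smooth_at p f -> smooth_at p g ->
  exists w, [/\ open w, w p, smooth_on w f & smooth_on w g].
Proof.
move=> [w [ow wp sf]] [w' [ow' wp' sg]]; exists (w `&` w'); split=> //.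
- exact: openI.
- by apply: smooth_onS sf => q [].
- by apply: smooth_onS sg => q [].
Qed.

Lemma smooth_at_mul p f g : smooth_at p f -> smooth_at p g ->
  smooth_at p (fun x => f x * g x).
Proof.
move=> sf sg; have [w [ow wp sf' sg']] := smooth_at2 sf sg.
by exists w; split=> //; exact: smooth_on_mul.
Qed.

Lemma smooth_at_add p f g : smooth_at p f -> smooth_at p g ->
  smooth_at p (fun x => f x + g x).
Proof.
move=> sf sg; have [w [ow wp sf' sg']] := smooth_at2 sf sg.
by exists w; split=> //; exact: smooth_on_add.
Qed.

Lemma smooth_at_cst p (a : R) : smooth_at p (fun=> a).
Proof. by exists setT; split=> //; [exact: openT | exact: smooth_on_cst]. Qed.

Section TangentVector.
Variables (p : M) (v : tvec M).
Hypothesis tv : tangent p v.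

Lemma tvec_lin (a : R) f g : smooth_at p f -> smooth_at p g ->
  v (fun x => a * f x + g x) = a * v f + v g.
Proof. by case: tv => _ _ H _; exact: H. Qed.

Lemma tvec_add f g : smooth_at p f -> smooth_at p g ->
  v (fun x => f x + g x) = v f + v g.
Proof.
move=> sf sg; rewrite -[v f]mul1r -tvec_lin//; congr v.
by apply/funext=> x; rewrite mul1r.
Qed.

Lemma tvec_sub f g : smooth_at p f -> smooth_at p g ->
  v (fun x => f x - g x) = v f - v g.
Proof.
move=> sf sg; rewrite addrC -mulN1r -tvec_lin//; congr v.
by apply/funext=> x; rewrite mulN1r addrC.
Qed.

Lemma tvec_mul f g : smooth_at p f -> smooth_at p g ->
  v (fun x => f x * g x) = f p * v g + v f * g p.
Proof. by case: tv => _ _ _; apply. Qed.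

(** When neither function is smooth at [p], both sides vanish. *)
Lemma tvec_germ f g : (\forall x \near p, f x = g x) -> v f = v g.
Proof.
move=> nfg; case: tv => H0 H _ _.
have [sf|nsf] := pselect (smooth_at p f).
  by apply: H => //; exact: smooth_at_ext sf.
rewrite !H0//; apply: contra_not nsf; apply: smooth_at_ext.
by apply: filterS nfg.
Qed.

Lemma tvec0 : v (fun=> 0) = 0.
Proof.
have := tvec_sub (smooth_at_cst p 0) (smooth_at_cst p 0).
rewrite [X in _ = X -> _]subrr => E; apply: etrans E; congr v.
by apply/funext=> x; rewrite subrr.
Qed.

Lemma tvec_nsmooth f : ~ smooth_at p f -> v f = 0.
Proof. by case: tv => H _ _ _; exact: H. Qed.

End TangentVector.

Lemma tangent_lin p (a : R) (v v' : tvec M) : tangent p v -> tangent p v' ->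
  tangent p (a *: v + v').
Proof.
move=> tv tv'; split.
- move=> f nf; change (a * v f + v' f = 0).
  by rewrite (tvec_nsmooth tv)// (tvec_nsmooth tv')// mulr0 addr0.
- move=> f g _ _ nfg; change (a * v f + v' f = a * v g + v' g).
  by rewrite (tvec_germ tv nfg) (tvec_germ tv' nfg).
- move=> b f g sf sg.
  change (a * v (fun x => b * f x + g x) + v' (fun x => b * f x + g x) =
          b * (a * v f + v' f) + (a * v g + v' g)).
  by rewrite (tvec_lin tv)// (tvec_lin tv')//; ring.
- move=> f g sf sg.
  change (a * v (fun x => f x * g x) + v' (fun x => f x * g x) =
          f p * (a * v g + v' g) + (a * v f + v' f) * g p).
  by rewrite (tvec_mul tv)// (tvec_mul tv')//; ring.
Qed.

Lemma smooth_at_vf w p X f : open w -> w p -> smooth_vfield w X ->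
  smooth_at p f -> smooth_at p (fun q => X q f).
Proof.
move=> ow wp [_ sX] [w' [ow' wp' sf]]; exists (w `&` w'); split=> //.
  exact: openI.
by apply: sX => [|q []//|]; [exact: openI | apply: smooth_onS sf => q []].
Qed.

Lemma bracketE p X Y f : smooth_at p f ->
  bracket X Y p f = X p (fun q => Y q f) - Y p (fun q => X q f).
Proof. by move=> sf; rewrite /bracket asboolT. Qed.

Lemma bracketN p X Y f : ~ smooth_at p f -> bracket X Y p f = 0.
Proof. by move=> sf; rewrite /bracket asboolF. Qed.

Lemma bracketC p X Y : bracket X Y p = - bracket Y X p.
Proof.
apply/funext => f; change (bracket X Y p f = - bracket Y X p f).
have [sf|nf] := pselect (smooth_at p f); last by rewrite !bracketN ?oppr0.
by rewrite !bracketE// opprB.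
Qed.

Lemma bracketXX p X : bracket X X p = 0.
Proof.
apply/funext => f; change (bracket X X p f = 0).
have [sf|nf] := pselect (smooth_at p f); last by rewrite bracketN.
by rewrite bracketE// subrr.
Qed.

Section Bracket.
Variable w : set M.
Hypothesis ow : open w.

Lemma smooth_vfield_bracket X Y : smooth_vfield w X -> smooth_vfield w Y ->
  smooth_vfield w (bracket X Y).
Proof.
move=> sX sY; have [tX fX] := sX; have [tY fY] := sY; split; last first.
  move=> w' f ow' w'w sf.
  have sXY : smooth_on w' (fun p => X p (fun q => Y q f)).
    by apply: fX => //; exact: fY.
  have sYX : smooth_on w' (fun p => Y p (fun q => X q f)).
    by apply: fY => //; exact: fX.
  apply: smooth_on_ext (smooth_on_lin (-1) ow' sYX sXY) => // p w'p.
  rewrite bracketE; last exact: smooth_at_on w'p sf.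
  by rewrite -[LHS]/(-1 * Y p (fun q => X q f) + X p (fun q => Y q f)) mulN1r addrC.
move=> p wp; have {tX}tX := tX p wp; have {tY}tY := tY p wp.
have sXf f : smooth_at p f -> smooth_at p (fun q => X q f).
  exact: smooth_at_vf ow wp sX.
have sYf f : smooth_at p f -> smooth_at p (fun q => Y q f).
  exact: smooth_at_vf ow wp sY.
have nw : \forall q \near p, w q by apply: (near_open ow wp).
split; first by move=> f nf; rewrite bracketN.
- move=> f g sf sg nfg; rewrite !bracketE//.
  have [V [oV Vp Vfg]] := open_nbhsE nfg.
  have E q : V q -> (\forall x \near q, f x = g x).
    by move=> Vq; apply: (near_open oV Vq).
  have nV : \forall q \near p, w q /\ V q.
    by apply: filterI => //; exact: open_nbhs_nbhs.
  congr (_ - _); [apply: (tvec_germ tX)|apply: (tvec_germ tY)].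
    apply: (filterS _ nV) => q [wq Vq].
    by apply: tvec_germ (E _ Vq); case: sY => + _; exact.
  apply: (filterS _ nV) => q [wq Vq].
  by apply: tvec_germ (E _ Vq); case: sX => + _; exact.
- move=> a f g sf sg.
  have sfg : smooth_at p (a *: f + g).
    apply: smooth_at_add (_ : smooth_at p (a *: f)) sg.
    exact: smooth_at_mul (smooth_at_cst p a) sf.
  rewrite !bracketE//.
  have nfg : \forall q \near p, [/\ w q, smooth_at q f & smooth_at q g].
    near=> q; split; near: q => //; exact: smooth_at_nbhs.
  rewrite (tvec_germ tX (g := fun q => a * Y q f + Y q g)); last first.
    apply: filterS nfg => q [wq sfq sgq]; apply: tvec_lin sfq sgq.
    by case: sY => + _; exact.
  rewrite (tvec_germ tY (g := fun q => a * X q f + X q g)); last first.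
    apply: filterS nfg => q [wq sfq sgq]; apply: tvec_lin sfq sgq.
    by case: sX => + _; exact.
  rewrite (tvec_lin tX) ?(tvec_lin tY); auto.
  rewrite /GRing.scale /=; ring.
- move=> f g sf sg; rewrite !bracketE//; last exact: smooth_at_mul.
  have nfg : \forall q \near p, [/\ w q, smooth_at q f & smooth_at q g].
    near=> q; split; near: q => //; exact: smooth_at_nbhs.
  rewrite (tvec_germ tX (g := fun q => f q * Y q g + Y q f * g q)); last first.
    apply: filterS nfg => q [wq sfq sgq]; apply: tvec_mul sfq sgq.
    by case: sY => + _; exact.
  rewrite (tvec_germ tY (g := fun q => f q * X q g + X q f * g q)); last first.
    apply: filterS nfg => q [wq sfq sgq]; apply: tvec_mul sfq sgq.
    by case: sX => + _; exact.
  have := sXf _ sf; have := sXf _ sg; have := sYf _ sf; have := sYf _ sg.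
  move=> s1 s2 s3 s4.
  rewrite (tvec_add tX) ?(tvec_add tY) ?(tvec_mul tX) ?(tvec_mul tY);
    try exact: smooth_at_mul; auto.
  ring.
Unshelve. all: by end_near. Qed.

Lemma bracket_tensor X X' X'' Y f p : w p ->
  smooth_vfield w X -> smooth_vfield w X'' -> smooth_vfield w Y -> smooth_on w f ->
  (forall q, w q -> X' q = f q *: X q + X'' q) ->
  bracket X' Y p = f p *: bracket X Y p - Y p f *: X p + bracket X'' Y p.
Proof.
move=> wp sX sX'' sY sf EX; apply/funext=> g.
change (bracket X' Y p g = f p * bracket X Y p g - Y p f * X p g + bracket X'' Y p g).
have tX : tangent p (X p) by case: sX => + _; exact.
have tY : tangent p (Y p) by case: sY => + _; exact.
have [sg|ng] := pselect (smooth_at p g); last first.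
  by rewrite !bracketN// (tvec_nsmooth tX)// !mulr0 subrr addr0.
rewrite !bracketE//.
have -> : X' p (fun q => Y q g) = f p * X p (fun q => Y q g) + X'' p (fun q => Y q g).
  by rewrite EX.
have sfp : smooth_at p f by exact: (smooth_at_on ow wp sf).
have s1 : smooth_at p (fun q => X q g) by exact: (smooth_at_vf ow wp sX sg).
have s2 : smooth_at p (fun q => X'' q g) by exact: (smooth_at_vf ow wp sX'' sg).
rewrite (tvec_germ tY (g := fun q => f q * X q g + X'' q g)); last first.
  by apply: (near_open ow wp) => q wq; rewrite EX.
rewrite (tvec_add tY)//; last exact: smooth_at_mul.
rewrite (tvec_mul tY)//; ring.
Qed.

Lemma jacobi X Y Z p : w p ->
  smooth_vfield w X -> smooth_vfield w Y -> smooth_vfield w Z ->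
  bracket X (bracket Y Z) p = bracket (bracket X Y) Z p + bracket Y (bracket X Z) p.
Proof.
move=> wp sX sY sZ; apply/funext=> g.
change (bracket X (bracket Y Z) p g =
  bracket (bracket X Y) Z p g + bracket Y (bracket X Z) p g).
have [sg|ng] := pselect (smooth_at p g); last by rewrite !bracketN ?addr0.
have sg' := smooth_at_nbhs sg.
have tan V : smooth_vfield w V -> tangent p (V p) by case=> + _; exact.
have sm V h : smooth_vfield w V -> smooth_at p h -> smooth_at p (fun q => V q h).
  exact: smooth_at_vf.
have E V W V' : smooth_vfield w V -> smooth_vfield w W -> smooth_vfield w V' ->
  V' p (fun q => bracket V W q g) =
  V' p (fun q => V q (fun q => W q g)) - V' p (fun q => W q (fun q => V q g)).
  move=> sV sW sV'.
  rewrite (tvec_germ (tan _ sV') (g := fun q =>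
      V q (fun q => W q g) - W q (fun q => V q g))); last first.
    by apply: filterS sg' => q sgq; rewrite bracketE.
  by rewrite (tvec_sub (tan _ sV')); auto.
have E2 V W V' : smooth_vfield w V -> smooth_vfield w W -> smooth_vfield w V' ->
  bracket V' (bracket V W) p g = 
  V' p (fun q => V q (fun q => W q g)) - V' p (fun q => W q (fun q => V q g)) -
  (V p (fun q => W q (fun q => V' q g)) - W p (fun q => V q (fun q => V' q g))).
  by move=> sV sW sV'; rewrite bracketE// E// bracketE//; auto.
rewrite [bracket (bracket X Y) Z p g](_ : _ = - bracket Z (bracket X Y) p g); last first.
  by rewrite bracketC.
rewrite !E2//; ring.
Qed.

End Bracket.
End Fields.

(** * Sections of the distribution *)

Section VerticalFields.
Context {R : realType} {n k : nat} {M : manifold R n} (F : foliation M k).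
Implicit Types (u w : set M) (p : M) (f g : M -> R^o) (X Y Z : vfield M).

Lemma fol_dist_lin p (a : R) (v v' : tvec M) :
  fol_dist F p v -> fol_dist F p v' -> fol_dist F p (a *: v + v').
Proof.
have [w [E [_ wp _ /(_ p wp)[-> _]]]] := fol_frame F p.
move=> [b ->] [b' ->]; exists (fun i => a * b i + b' i).
rewrite scaler_sumr -big_split /=; apply: eq_bigr => i _.
by rewrite scalerA scalerDl.
Qed.

Lemma vsec_lin w f X Y : open w -> smooth_on w f -> vsec F w X -> vsec F w Y ->
  vsec F w (fun p => f p *: X p + Y p).
Proof.
move=> ow sf [[tX sX] vX] [[tY sY] vY]; split=> [|p wp]; last first.
  by apply: fol_dist_lin; [exact: vX|exact: vY].
split=> [p wp|w' g ow' w'w sg]; first by apply: tangent_lin; [exact: tX|exact: tY].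
apply: smooth_on_add => //; last exact: sY.
by apply: smooth_on_mul => //; [exact: smooth_onS sf|exact: sX].
Qed.

Lemma vsec_bracket w X Y : open w -> vsec F w X -> vsec F w Y ->
  vsec F w (bracket X Y).
Proof.
move=> ow [sX vX] [sY vY]; split; first exact: smooth_vfield_bracket.
exact: (fol_involutive ow sX sY vX vY).
Qed.

Lemma vsec_ext w X Y : (forall p, w p -> X p = Y p) -> vsec F w X -> vsec F w Y.
Proof.
move=> XY [[tX sX] vX]; split=> [|p wp]; last by rewrite -XY//; exact: vX.
split=> [p wp|w' g ow' w'w sg]; first by rewrite -XY//; exact: tX.
apply: smooth_on_ext (sX w' g ow' w'w sg) => // p w'p.
by rewrite XY//; exact: w'w.
Qed.

Lemma vsec_tan w X p : vsec F w X -> w p -> tangent p (X p).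
Proof. by case=> -[+ _] _; exact. Qed.

Lemma tvec_cst p (v : tvec M) (a : R) : tangent p v -> v (fun=> a) = 0.
Proof.
move=> tv; have s1 := smooth_at_cst p.
have v1 : v (fun=> 1) = 0.
  have := tvec_mul tv (s1 1) (s1 1).
  rewrite (_ : (fun x : M => 1 * 1 : R) = (fun=> 1)); last first.
    by apply/funext => x; rewrite mul1r.
  by rewrite mul1r mulr1 => /eqP; rewrite -subr_eq subrr => /eqP.
have E := tvec_lin tv a (s1 1) (s1 0).
have -> : (fun=> a) = (fun x : M => a * 1 + 0 : R^o).
  by apply/funext => x; rewrite mulr1 addr0.
by apply: etrans E _; rewrite (tvec0 tv) v1 mulr0 addr0.
Qed.

Definition vsecs w (Ys : seq (vfield M)) : Prop :=
  forall Y, Y \in Ys -> vsec F w Y.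

Lemma vsecs_cons w Y Ys : vsecs w (Y :: Ys) <-> vsec F w Y /\ vsecs w Ys.
Proof.
split=> [H|[HY H] Z].
  by split=> [|Z ZY]; apply: H; rewrite inE ?eqxx// ZY orbT.
by rewrite inE => /orP[/eqP->|/H].
Qed.

Lemma vsecs_cat w s t : vsecs w (s ++ t) <-> vsecs w s /\ vsecs w t.
Proof.
split=> [H|[Hs Ht] Z]; last by rewrite mem_cat => /orP[/Hs|/Ht].
by split=> Z HZ; apply: H; rewrite mem_cat HZ ?orbT.
Qed.

(** * Cartan calculus *)

(** Cochains of the Lie algebra of vertical fields with values in the functions,
    without reference to a degree. *)
Definition cochain := seq (vfield M) -> M -> R^o.
Implicit Types c : cochain.

Definition iprod Y c : cochain := fun Ys => c (Y :: Ys).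

(** The Lie derivative, by recursion on [i_Y L_X = L_X i_Y - i_[X, Y]]. *)
Fixpoint Lie X c (Ys : seq (vfield M)) {struct Ys} : M -> R^o :=
  if Ys is Y :: Ys' then
    fun p => Lie X (iprod Y c) Ys' p - c (bracket X Y :: Ys') p
  else fun p => X p (c [::]).

(** The exterior differential, by recursion on Cartan's formula
    [i_X d = L_X - d i_X]. *)
Fixpoint CE c (Xs : seq (vfield M)) {struct Xs} : M -> R^o :=
  if Xs is X :: Xs' then fun p => Lie X c Xs' p - CE (iprod X c) Xs' p
  else fun=> 0.

Section OnOpen.
Variable w : set M.
Hypothesis ow : open w.

Definition smooth_cochain c := forall Ys, vsecs w Ys -> smooth_on w (c Ys).

Lemma smooth_on_sub f g : smooth_on w f -> smooth_on w g ->
  smooth_on w (fun x => f x - g x).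
Proof.
move=> sf sg; apply: smooth_on_ext (smooth_on_lin (-1) ow sg sf) => // p _.
by rewrite -[LHS]/(-1 * g p + f p) mulN1r addrC.
Qed.

Lemma smooth_iprod Y c : vsec F w Y -> smooth_cochain c -> smooth_cochain (iprod Y c).
Proof. by move=> vY sc Ys vYs; apply: sc; apply/vsecs_cons. Qed.

Lemma smooth_Lie X c : vsec F w X -> smooth_cochain c -> smooth_cochain (Lie X c).
Proof.
move=> vX sc Ys; elim: Ys c sc => [|Y Ys IH] c sc.
  by move=> _; case: vX => -[_ sX] _; apply: sX => //; exact: sc.
move=> /vsecs_cons[vY vYs]; apply: smooth_on_sub.
  by apply: IH => //; exact: smooth_iprod.
by apply: sc; apply/vsecs_cons; split=> //; exact: vsec_bracket.
Qed.

Lemma smooth_CE c : smooth_cochain c -> smooth_cochain (CE c).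
Proof.
move=> sc Ys; elim: Ys c sc => [|Y Ys IH] c sc; first by move=> _; exact: smooth_on_cst.
move=> /vsecs_cons[vY vYs]; apply: smooth_on_sub; first exact: smooth_Lie.
by apply: IH => //; exact: smooth_iprod.
Qed.

(** The relevant equality of cochains: both sides are unconstrained on fields that
    are not vertical over [w], and at points off [w]. *)
Definition eqc c c' := forall Ys p, vsecs w Ys -> w p -> c Ys p = c' Ys p.

Lemma eqc_iprod Y c c' : vsec F w Y -> eqc c c' -> eqc (iprod Y c) (iprod Y c').
Proof. by move=> vY E Ys p vYs wp; apply: E => //; apply/vsecs_cons. Qed.

Lemma Lie_eqc X c c' : vsec F w X -> eqc c c' -> eqc (Lie X c) (Lie X c').
Proof.
move=> vX E Ys; elim: Ys c c' E => [|Y Ys IH] c c' E p.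
  move=> _ wp; apply: (tvec_germ (vsec_tan vX wp)).
  by apply: (near_open ow wp) => q wq; exact: E.
move=> /vsecs_cons[vY vYs] wp /=; congr (_ - _).
  by apply: IH => //; exact: eqc_iprod.
by apply: E => //; apply/vsecs_cons; split=> //; exact: vsec_bracket.
Qed.

Lemma CE_eqc c c' : eqc c c' -> eqc (CE c) (CE c').
Proof.
move=> E Ys; elim: Ys c c' E => [|Y Ys IH] c c' E p //.
move=> /vsecs_cons[vY vYs] wp /=; congr (_ - _); first exact: Lie_eqc.
by apply: IH => //; exact: eqc_iprod.
Qed.

Lemma Lie_mulD X f c c' Ys p : vsec F w X -> smooth_on w f ->
  smooth_cochain c -> smooth_cochain c' -> vsecs w Ys -> w p ->
  Lie X (fun Zs q => f q * c Zs q + c' Zs q) Ys p =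
  X p f * c Ys p + f p * Lie X c Ys p + Lie X c' Ys p.
Proof.
move=> vX sf + + + wp; elim: Ys c c' => [|Y Ys IH] c c' sc sc'.
  move=> _ /=; have tX := vsec_tan vX wp.
  have s1 : smooth_at p f by exact: (smooth_at_on ow wp).
  have s2 : smooth_at p (c [::]) by apply: (smooth_at_on ow wp); exact: sc.
  have s3 : smooth_at p (c' [::]) by apply: (smooth_at_on ow wp); exact: sc'.
  rewrite (tvec_add tX (f := fun q => f q * c [::] q))//; last exact: smooth_at_mul.
  by rewrite (tvec_mul tX)// [X in X + _ = _]addrC.
move=> /vsecs_cons[vY vYs] /=.
rewrite -[iprod Y _]/(fun Zs q => f q * iprod Y c Zs q + iprod Y c' Zs q).
rewrite IH//; try exact: smooth_iprod.
rewrite -[iprod Y c Ys p]/(c (Y :: Ys) p); ring.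
Qed.

Lemma Lie_lin X (a : R) c c' Ys p : vsec F w X ->
  smooth_cochain c -> smooth_cochain c' -> vsecs w Ys -> w p ->
  Lie X (fun Zs q => a * c Zs q + c' Zs q) Ys p = a * Lie X c Ys p + Lie X c' Ys p.
Proof.
move=> vX sc sc' vYs wp.
have := @Lie_mulD X (fun=> a) c c' Ys p vX (smooth_on_cst _ _) sc sc' vYs wp.
by rewrite (tvec_cst _ (vsec_tan vX wp)) mul0r add0r.
Qed.

Lemma Lie_sub X c c' Ys p : vsec F w X ->
  smooth_cochain c -> smooth_cochain c' -> vsecs w Ys -> w p ->
  Lie X (fun Zs q => c Zs q - c' Zs q) Ys p = Lie X c Ys p - Lie X c' Ys p.
Proof.
move=> vX sc sc' vYs wp; rewrite addrC -mulN1r -Lie_lin//.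
by apply: Lie_eqc => // Zs q _ _; rewrite mulN1r addrC.
Qed.

Lemma CE_lin (a : R) c c' Ys p :
  smooth_cochain c -> smooth_cochain c' -> vsecs w Ys -> w p ->
  CE (fun Zs q => a * c Zs q + c' Zs q) Ys p = a * CE c Ys p + CE c' Ys p.
Proof.
move=> + + + wp; elim: Ys c c' => [|Y Ys IH] c c' sc sc'.
  by rewrite /= mulr0 addr0.
move=> /vsecs_cons[vY vYs] /=; rewrite Lie_lin//.
rewrite -[iprod Y _]/(fun Zs q => a * iprod Y c Zs q + iprod Y c' Zs q).
rewrite IH//; try exact: smooth_iprod.
ring.
Qed.

Lemma CE_sub c c' Ys p :
  smooth_cochain c -> smooth_cochain c' -> vsecs w Ys -> w p ->
  CE (fun Zs q => c Zs q - c' Zs q) Ys p = CE c Ys p - CE c' Ys p.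
Proof.
move=> sc sc' vYs wp; rewrite addrC -mulN1r -CE_lin//.
by apply: CE_eqc => // Zs q _ _; rewrite mulN1r addrC.
Qed.

Lemma CE_opp c Ys p : smooth_cochain c -> vsecs w Ys -> w p ->
  CE (fun Zs q => - c Zs q) Ys p = - CE c Ys p.
Proof.
move=> sc vYs wp; have := CE_lin (-2) sc sc vYs wp.
rewrite (_ : -2 * _ + _ = - CE c Ys p); last by ring.
by move=> <-; apply: CE_eqc => // Zs q _ _; ring.
Qed.

Lemma Lie0 X Ys p : vsec F w X -> vsecs w Ys -> w p ->
  Lie X (fun _ _ => 0) Ys p = 0.
Proof.
move=> vX + wp; elim: Ys => [|Y Ys IH] /=; first by rewrite (tvec_cst _ (vsec_tan vX wp)).
by move=> /vsecs_cons[_ vYs]; rewrite subr0; exact: IH.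
Qed.

Lemma CE0 Ys p : vsecs w Ys -> w p -> CE (fun _ _ => 0) Ys p = 0.
Proof.
move=> + wp; elim: Ys => [//|Y Ys IH] /vsecs_cons[vY vYs] /=.
by rewrite Lie0// sub0r; apply/eqP; rewrite oppr_eq0; apply/eqP; exact: IH.
Qed.

(** Alternating forms on [w], of unspecified degree, so that contraction by a
    vertical field is an endomorphism of this class. *)
Definition mform (o : preform M) : Prop := [/\
  forall p s1 s2 (a : R) v v', w p -> fol_dist F p v -> fol_dist F p v' ->
    o p (s1 ++ (a *: v + v') :: s2) = a * o p (s1 ++ v :: s2) + o p (s1 ++ v' :: s2),
  forall p s1 s2 v, w p -> o p (s1 ++ v :: v :: s2) = 0 &
  forall w' Xs, open w' -> w' `<=` w -> vsecs w' Xs ->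
    smooth_on w' (fun p => o p [seq X p | X <- Xs])].

Definition ev (o : preform M) : cochain := fun Ys p => o p [seq Y p | Y <- Ys].

Definition contr Y (o : preform M) : preform M := fun p s => o p (Y p :: s).

Lemma iprod_ev Y o : iprod Y (ev o) = ev (contr Y o). Proof. by []. Qed.

Lemma mform_contr Y o : vsec F w Y -> mform o -> mform (contr Y o).
Proof.
move=> vY [h1 h2 h3]; split.
- by move=> p s1 s2 a v v' wp Vv Vv'; exact: (h1 p (Y p :: s1)).
- by move=> p s1 s2 v wp; exact: (h2 p (Y p :: s1)).
- move=> w' Xs ow' w'w vXs; apply: (h3 w' (Y :: Xs)) => //.
  by apply/vsecs_cons; split=> //; exact: vsecS vY.
Qed.

Lemma smooth_ev o : mform o -> smooth_cochain (ev o).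
Proof. by move=> [_ _ h3] Ys vYs; exact: (h3 w). Qed.

Section Form.
Variable o : preform M.
Hypothesis mo : mform o.

Lemma mform_swap p s1 s2 v v' : w p -> fol_dist F p v -> fol_dist F p v' ->
  o p (s1 ++ v :: v' :: s2) = - o p (s1 ++ v' :: v :: s2).
Proof.
have [h1 h2 _] := mo; move=> wp Vv Vv'.
have Vs : fol_dist F p (1 *: v + v') by exact: fol_dist_lin.
have := h2 p s1 s2 (1 *: v + v') wp.
have E x := h1 p (rcons s1 x) s2 1 v v' wp Vv Vv'.
rewrite h1// -!(cat_rcons _ _ (_ :: s2)) !E !cat_rcons !h2//.
by rewrite !mul1r add0r addr0 => /eqP; rewrite addrC addr_eq0 => /eqP ->; rewrite opprK.
Qed.

End Form.

Lemma vsec_dist X p : vsec F w X -> w p -> fol_dist F p (X p).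
Proof. by case=> _; apply. Qed.

Lemma ev_tensor o s1 s2 X X' X'' p (a : R) : mform o -> w p ->
  vsec F w X -> vsec F w X'' -> X' p = a *: X p + X'' p ->
  ev o (s1 ++ X' :: s2) p = a * ev o (s1 ++ X :: s2) p + ev o (s1 ++ X'' :: s2) p.
Proof.
move=> [h1 _ _] wp vX vX'' E; rewrite /ev !map_cat /= E h1//; exact: vsec_dist.
Qed.

Lemma ev_swap o s1 s2 X Y p : mform o -> w p -> vsec F w X -> vsec F w Y ->
  ev o (s1 ++ X :: Y :: s2) p = - ev o (s1 ++ Y :: X :: s2) p.
Proof.
by move=> mo wp vX vY; rewrite /ev !map_cat /= (mform_swap mo)//; exact: vsec_dist.
Qed.

(** By induction on the list: after contraction with [Z], the two sides differ by
    the Jacobi identity for [X], [Y] and [Z], inserted into [o]. *)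
Lemma Lie_comm o X Y Zs p : mform o -> vsec F w X -> vsec F w Y -> vsecs w Zs -> w p ->
  Lie X (Lie Y (ev o)) Zs p - Lie Y (Lie X (ev o)) Zs p =
  Lie (bracket X Y) (ev o) Zs p.
Proof.
move=> + vX vY + wp; elim: Zs o => [|Z Zs IH] o mo.
  move=> _ /=; rewrite bracketE//; apply: (smooth_at_on ow wp).
  exact: (smooth_ev mo).
move=> /vsecs_cons[vZ vZs] /=.
have vXZ := vsec_bracket ow vX vZ; have vYZ := vsec_bracket ow vY vZ.
have mZ := mform_contr vZ mo; have mXZ := mform_contr vXZ mo.
have mYZ := mform_contr vYZ mo.
rewrite -[iprod Z (Lie Y _)]/(fun Zs q => Lie Y (ev (contr Z o)) Zs q -
  ev (contr (bracket Y Z) o) Zs q).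
rewrite -[iprod Z (Lie X _)]/(fun Zs q => Lie X (ev (contr Z o)) Zs q -
  ev (contr (bracket X Z) o) Zs q).
rewrite !Lie_sub//; try exact: smooth_ev; try (apply: smooth_Lie => //; exact: smooth_ev).
rewrite !iprod_ev -(IH _ mZ vZs).
have -> : ev o (bracket (bracket X Y) Z :: Zs) p =
    ev o (bracket X (bracket Y Z) :: Zs) p - ev o (bracket Y (bracket X Z) :: Zs) p.
  have := @ev_tensor o [::] Zs (bracket (bracket X Y) Z) (bracket X (bracket Y Z))
    (bracket Y (bracket X Z)) p 1 mo wp.
  rewrite scale1r mul1r /= => ->; first by rewrite addrK.
  - by apply: vsec_bracket => //; exact: vsec_bracket.
  - exact: vsec_bracket.
  - by apply: (jacobi ow wp); [case: vX|case: vY|case: vZ].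
ring.
Qed.

(** By induction: contracting with [Y], both sides become
    [L_Y L_X - d L_X i_Y + d i_[X, Y]], by [Lie_comm]. *)
Lemma Lie_CE o X Zs p : mform o -> vsec F w X -> vsecs w Zs -> w p ->
  Lie X (CE (ev o)) Zs p = CE (Lie X (ev o)) Zs p.
Proof.
move=> + vX + wp; elim: Zs o => [|Y Ys IH] o mo.
  by move=> _ /=; rewrite (tvec_cst _ (vsec_tan vX wp)).
move=> /vsecs_cons[vY vYs] /=.
have vXY := vsec_bracket ow vX vY.
have mY := mform_contr vY mo; have mXY := mform_contr vXY mo.
rewrite -[iprod Y (CE _)]/(fun Zs q => Lie Y (ev o) Zs q - CE (ev (contr Y o)) Zs q).
rewrite -[iprod Y (Lie X _)]/(fun Zs q => Lie X (ev (contr Y o)) Zs q -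
  ev (contr (bracket X Y) o) Zs q).
have so := smooth_ev mo; have sY := smooth_ev mY; have sXY := smooth_ev mXY.
rewrite Lie_sub ?CE_sub//; try exact: smooth_Lie; try exact: smooth_CE.
rewrite IH// -(Lie_comm mo vX vY vYs wp) !iprod_ev; ring.
Qed.

(** Contracting with [X], [i_X d d = L_X d - d i_X d = L_X d - d L_X + d d i_X];
    the first two terms cancel and the last vanishes by induction. *)
Lemma CE_CE o Xs p : mform o -> vsecs w Xs -> w p -> CE (CE (ev o)) Xs p = 0.
Proof.
move=> + + wp; elim: Xs o => [//|X Xs IH] o mo /vsecs_cons[vX vXs] /=.
rewrite -[iprod X (CE _)]/(fun Zs q => Lie X (ev o) Zs q - CE (ev (contr X o)) Zs q).
have mX := mform_contr vX mo.
have so := smooth_ev mo; have sX := smooth_ev mX.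
rewrite CE_sub//; [|exact: smooth_Lie|exact: smooth_CE].
by rewrite Lie_CE// (IH _ mX vXs) subr0 subrr.
Qed.

Lemma Lie_alt o Z s1 s2 X p : mform o -> vsec F w Z -> vsec F w X ->
  vsecs w s1 -> vsecs w s2 -> w p -> Lie Z (ev o) (s1 ++ X :: X :: s2) p = 0.
Proof.
move=> + vZ vX + vs2 wp; elim: s1 o => [|Y s1 IH] o mo.
  move=> _ /=; have vZX := vsec_bracket ow vZ vX.
  rewrite (Lie_eqc (c' := fun _ _ => 0))//; last first.
    by move=> Ys q _ wq; have [_ h2 _] := mo; exact: (h2 q [::]).
  rewrite Lie0// sub0r -opprD iprod_ev.
  rewrite -[ev (contr X o) _ p]/(ev o ([::] ++ [:: X, bracket Z X & s2]) p).
  by rewrite ev_swap// addNr oppr0.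
move=> /vsecs_cons[vY vs1]; rewrite cat_cons /= iprod_ev IH//; last exact: mform_contr.
rewrite /ev /= map_cat /=; case: mo => _ h _.
by rewrite (h p (bracket Z Y p :: [seq W p | W <- s1]))// subrr.
Qed.

(** At the head of the list, [i_X i_X d] is
    [i_X L_X - i_X d i_X = i_X L_X - L_X i_X + d i_X i_X], that is
    [- i_[X, X] + d i_X i_X]. *)
Lemma CE_alt_adj o s1 s2 X p : mform o -> vsec F w X ->
  vsecs w s1 -> vsecs w s2 -> w p -> CE (ev o) (s1 ++ X :: X :: s2) p = 0.
Proof.
move=> + vX + vs2 wp; elim: s1 o => [|Y s1 IH] o mo.
  move=> _ /=; have [h1 h2 _] := mo.
  rewrite (CE_eqc (c' := fun _ _ => 0))//; last first.
    by move=> Ys q _ wq; exact: (h2 q [::]).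
  rewrite CE0// subr0 addrAC subrr sub0r.
  have v0 := vsec0 F w.
  have := @ev_tensor o [::] s2 0 0 0 p 1 mo wp v0 v0.
  rewrite scaler0 addr0 => /(_ erefl) /= /eqP.
  rewrite mul1r -subr_eq subrr => /eqP z.
  have := @ev_tensor o [::] s2 0 (bracket X X) 0 p 0 mo wp v0 v0.
  rewrite bracketXX scaler0 addr0 => /(_ erefl) /= ->.
  by rewrite -z mulr0 addr0 oppr0.
move=> /vsecs_cons[vY vs1]; rewrite cat_cons /= iprod_ev IH//; last exact: mform_contr.
by rewrite Lie_alt// subrr.
Qed.

(** Tensoriality. The identity [X' = f X + X''] is required on [w] only; with
    [f = 0] the lemma says that only the values of the fields on [w] matter. *)
Section Tensor.
Variables (f : M -> R^o) (X X' X'' : vfield M).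
Hypotheses (sf : smooth_on w f) (vX : vsec F w X) (vX'' : vsec F w X'').
Hypothesis EX : forall q, w q -> X' q = f q *: X q + X'' q.

Lemma vsec_tensor : vsec F w X'.
Proof. by apply: vsec_ext (vsec_lin ow sf vX vX'') => p wp; rewrite EX. Qed.

Lemma iprod_tensor o : mform o -> eqc (iprod X' (ev o))
  (fun Ys q => f q * ev (contr X o) Ys q + ev (contr X'' o) Ys q).
Proof.
by move=> mo Ys q vYs wq; apply: (@ev_tensor o [::] Ys) => //; exact: EX.
Qed.

Lemma Lie_tensor o Z s1 s2 p : mform o -> vsec F w Z -> vsecs w s1 -> vsecs w s2 ->
  w p -> Lie Z (ev o) (s1 ++ X' :: s2) p =
    f p * Lie Z (ev o) (s1 ++ X :: s2) p + Lie Z (ev o) (s1 ++ X'' :: s2) p.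
Proof.
move=> + vZ + vs2 wp; elim: s1 o => [|Y s1 IH] o mo.
  move=> _ /=; rewrite (Lie_eqc vZ (iprod_tensor mo))//.
  have m1 := mform_contr vX mo; have m2 := mform_contr vX'' mo.
  rewrite Lie_mulD//; try exact: smooth_ev.
  rewrite !iprod_ev.
  have vZX := vsec_bracket ow vZ vX; have vZX'' := vsec_bracket ow vZ vX''.
  have E : bracket Z X' p = f p *: bracket Z X p +
      (Z p f *: X p + bracket Z X'' p).
    rewrite bracketC (bracket_tensor ow wp _ _ _ sf EX);
      [|by case: vX|by case: vX''|by case: vZ].
    rewrite [bracket Z X p]bracketC [bracket Z X'' p]bracketC.
    by rewrite !opprD opprK scalerN addrA.
  have vB : vsec F w (fun q => Z q f *: X q + bracket Z X'' q).
    by apply: vsec_lin => //; case: vZ => -[_ sZ] _; exact: sZ.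
  rewrite (@ev_tensor o [::] s2 (bracket Z X) (bracket Z X')
    (fun q => Z q f *: X q + bracket Z X'' q) p (f p))//=.
  rewrite (@ev_tensor o [::] s2 X (fun q => Z q f *: X q + bracket Z X'' q)
    (bracket Z X'') p (Z p f))//=.
  rewrite -[ev (contr X o) s2 p]/(ev o (X :: s2) p); ring.
move=> /vsecs_cons[vY vs1]; rewrite !cat_cons /= iprod_ev IH//; last exact: mform_contr.
rewrite (@ev_tensor o (bracket Z Y :: s1) s2 X X' X'' p (f p))//=; last exact: EX.
ring.
Qed.

(** The failure of [L_X] to be linear over functions in [X] is cancelled by that of
    [d i_X]. Contracting with [Y], the term [- (Y f) X] of [[f X, Y]] matches the
    term [(Y f) i_X] of [L_Y (f i_X)], and [i_X i_Y = - i_Y i_X]. *)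
Lemma Lie_CE_tensor o Ys p : mform o -> vsecs w Ys -> w p ->
  Lie X' (ev o) Ys p - Lie X'' (ev o) Ys p - f p * Lie X (ev o) Ys p =
  CE (fun Zs q => f q * ev (contr X o) Zs q) Ys p - f p * CE (ev (contr X o)) Ys p.
Proof.
move=> + + wp; elim: Ys o => [|Y Ys IH] o mo.
  move=> _ /=; rewrite EX//.
  rewrite -[(f p *: X p + X'' p) _]/(f p * X p (ev o [::]) + X'' p (ev o [::])).
  by rewrite mulr0 addrK subrr subr0.
move=> /vsecs_cons[vY vYs] /=; have mY := mform_contr vY mo; have mX := mform_contr vX mo.
rewrite !iprod_ev.
have mXY := mform_contr vX mY; have mYX := mform_contr vY mX.
have sXY := smooth_ev mXY; have sYX := smooth_ev mYX; have sX := smooth_ev mX.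
have vXY := vsec_bracket ow vX vY; have vXY'' := vsec_bracket ow vX'' vY.
have IHY := IH _ mY vYs.
rewrite -[iprod Y _]/(fun Zs q => f q * ev (contr Y (contr X o)) Zs q).
have L : Lie Y (fun Zs q => f q * ev (contr X o) Zs q) Ys p =
    Y p f * ev (contr X o) Ys p + f p * Lie Y (ev (contr X o)) Ys p.
  have := @Lie_mulD Y f (ev (contr X o)) (fun _ _ => 0) Ys p vY sf sX _ vYs wp.
  rewrite Lie0// addr0 => <-; last by move=> *; exact: smooth_on_cst.
  by apply: Lie_eqc => // Zs q _ _; rewrite addr0.
have C (Zs : seq (vfield M)) q : vsecs w Zs -> w q ->
    ev (contr Y (contr X o)) Zs q = - ev (contr X (contr Y o)) Zs q.
  by move=> _ wq; exact: (@ev_swap o [::]).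
have E1 : CE (ev (contr Y (contr X o))) Ys p = - CE (ev (contr X (contr Y o))) Ys p.
  by rewrite -CE_opp//; apply: CE_eqc.
have E2 : CE (fun Zs q => f q * ev (contr Y (contr X o)) Zs q) Ys p =
    - CE (fun Zs q => f q * ev (contr X (contr Y o)) Zs q) Ys p.
  rewrite -CE_opp//.
    by apply: CE_eqc => // Zs q vZs wq; rewrite C// mulrN.
  by move=> Zs vZs; apply: smooth_on_mul => //; exact: sXY.
rewrite L E1 E2.
have E : bracket X' Y p = f p *: bracket X Y p + (- Y p f *: X p + bracket X'' Y p).
  rewrite (bracket_tensor ow wp _ _ _ sf EX); [|by case: vX|by case: vX''|by case: vY].
  by rewrite scaleNr addrA.
have sYf : smooth_on w (fun q => - Y q f).
  have sYf : smooth_on w (fun q => Y q f) by case: vY => -[_ sY] _; exact: sY.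
  by apply: smooth_on_ext (smooth_on_sub (smooth_on_cst _ 0) sYf) => // q _; rewrite sub0r.
have vB : vsec F w (fun q => - Y q f *: X q + bracket X'' Y q) by exact: vsec_lin.
rewrite (@ev_tensor o [::] Ys (bracket X Y) (bracket X' Y)
  (fun q => - Y q f *: X q + bracket X'' Y q) p (f p))//=.
rewrite (@ev_tensor o [::] Ys X (fun q => - Y q f *: X q + bracket X'' Y q)
  (bracket X'' Y) p (- Y p f))//=.
rewrite -[ev (contr X o) Ys p]/(ev o (X :: Ys) p).
move: IHY; set a := Lie X' _ Ys p; set b := Lie X'' _ Ys p; set c := Lie X _ Ys p.
set A := CE (fun Zs q => f q * ev (contr X (contr Y o)) Zs q) Ys p.
set B := CE (ev (contr X (contr Y o))) Ys p.
move=> IHY; have -> : a = A - f p * B + b + f p * c by rewrite -IHY; ring.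
ring.
Qed.

Lemma CE_tensor o s1 s2 p : mform o -> vsecs w s1 -> vsecs w s2 -> w p ->
  CE (ev o) (s1 ++ X' :: s2) p =
    f p * CE (ev o) (s1 ++ X :: s2) p + CE (ev o) (s1 ++ X'' :: s2) p.
Proof.
move=> + + vs2 wp; elim: s1 o => [|Y s1 IH] o mo.
  move=> _ /=; rewrite (CE_eqc (iprod_tensor mo))// !iprod_ev.
  have m1 := mform_contr vX mo; have m2 := mform_contr vX'' mo.
  have sm1 := smooth_ev m1; have sm2 := smooth_ev m2.
  have sfm : smooth_cochain (fun Zs q => f q * ev (contr X o) Zs q).
    by move=> Zs vZs; apply: smooth_on_mul => //; exact: sm1.
  have -> : CE (fun Ys q => f q * ev (contr X o) Ys q + ev (contr X'' o) Ys q) s2 p =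
      CE (fun Zs q => f q * ev (contr X o) Zs q) s2 p + CE (ev (contr X'' o)) s2 p.
    rewrite -[X in _ = X + _]mul1r -CE_lin//.
    by apply: CE_eqc => // Zs q _ _; rewrite mul1r.
  have := Lie_CE_tensor mo vs2 wp.
  set a := Lie X' _ s2 p; set b := Lie X'' _ s2 p; set c := Lie X _ s2 p.
  set A := CE _ _ _; set B := CE (ev (contr X o)) s2 p => H.
  have -> : a = A - f p * B + b + f p * c by rewrite -H; ring.
  ring.
move=> /vsecs_cons[vY vs1]; rewrite !cat_cons /= !iprod_ev IH//; last exact: mform_contr.
rewrite Lie_tensor//; ring.
Qed.

End Tensor.

End OnOpen.
End VerticalFields.

(** * Frames of the distribution *)

Section Frames.
Context {R : realType} {n k : nat} {M : manifold R n} (F : foliation M k).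
Implicit Types (u w : set M) (p : M) (f g : M -> R^o) (X Y Z : vfield M).

Lemma sum_tvecE (I : finType) (a : I -> R) (v : I -> tvec M) f :
  (\sum_i a i *: v i) f = \sum_i a i * v i f.
Proof. by rewrite fct_sumE. Qed.

(** Independent tangent vectors are separated by smooth germs, because a tangent
    vector vanishes on the functions that are not smooth at its base point. *)
Lemma dual_functions p (v : 'I_k -> tvec M) : (forall i, tangent p (v i)) ->
  (forall a : 'I_k -> R, \sum_i a i *: v i = 0 -> forall i, a i = 0) ->
  exists2 g : nat -> M -> R^o, forall j, smooth_at p (g j) &
    (\matrix_(j < k, i < k) (v i (g j) : R)) \in unitmx.
Proof.
move=> tv indep.
suff H r : (r <= k)%N -> exists2 g : nat -> M -> R^o, forall j, smooth_at p (g j) &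
    row_free (\matrix_(j < r, i < k) (v i (g j) : R)).
  by have [g sg fg] := H k (leqnn k); exists g => //; rewrite -row_free_unit.
(* A family of rank [r < k] is annihilated by some [a != 0]; since
   [\sum_i a i *: v i] is not zero, some [f] is not annihilated by [a], and adding it
   raises the rank. *)
elim: r => [_|r IH rk].
  exists (fun _ _ => 0) => [j|]; first exact: smooth_at_cst.
  by apply: inj_row_free => u _; apply/rowP => -[].
have [g sg fg] := IH (ltnW rk); set B := (X in row_free X) in fg.
have [a [a0 aB]] : exists a : 'rV[R]_k, a != 0 /\ a *m B^T = 0.
  have : kermx B^T != 0.
    rewrite -mxrank_eq0 mxrank_ker mxrank_tr.
    by move: fg; rewrite /row_free => /eqP ->; rewrite subn_eq0 -ltnNge.
  by move=> /rowV0Pn[a /sub_kermxP aB a0]; exists a.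
have [f vf] : exists f, \sum_i a ord0 i * v i f != 0.
  apply: contrapT => nf; move/eqP: a0; apply; apply/rowP => i; rewrite mxE.
  apply: (indep (fun i => a ord0 i)); apply/funext => f; rewrite sum_tvecE.
  by apply: contrapT => /eqP H; apply: nf; exists f.
have sf : smooth_at p f.
  apply: contrapT => nf; move/eqP: vf; apply; apply: big1 => i _.
  by rewrite (tvec_nsmooth (tv i))// mulr0.
exists (fun j => if (j == r)%N then f else g j); first by move=> j; case: ifP.
set B' := (X in row_free X); apply: inj_row_free => u uB'.
have B'E (j : 'I_r) i : B' (widen_ord (leqnSn r) j) i = B j i.
  by rewrite !mxE /= ltn_eqF.
have B'r i : B' ord_max i = v i f by rewrite mxE eqxx.
have uE i : \sum_(j < r) u ord0 (widen_ord (leqnSn r) j) * B j i +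
    u ord0 ord_max * v i f = 0.
  have := congr1 (fun A : 'rV[R]_k => A ord0 i) uB'.
  rewrite !mxE big_ord_recr /= B'r => E; rewrite -[RHS]E; congr (_ + _).
  by apply: eq_bigr => j _; rewrite B'E.
have ur : u ord0 ord_max = 0.
  have E : u ord0 ord_max * (\sum_i a ord0 i * v i f) = 0.
    rewrite mulr_sumr; have aBj (j : 'I_r) : \sum_i a ord0 i * B j i = 0.
      have := congr1 (fun A : 'rV[R]_r => A ord0 j) aB; rewrite !mxE => E.
      by rewrite -[RHS]E; apply: eq_bigr => i _; rewrite [X in _ = _ * X]mxE.
    transitivity (\sum_i a ord0 i *
        - \sum_(j < r) u ord0 (widen_ord (leqnSn r) j) * B j i).
      apply: eq_bigr => i _; rewrite mulrCA; congr (_ * _); apply/eqP.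
      by rewrite -subr_eq0 opprK addrC uE.
    transitivity (- \sum_(j < r) u ord0 (widen_ord (leqnSn r) j) *
        \sum_i a ord0 i * B j i).
      rewrite (eq_bigr (fun i => - \sum_(j < r)
          u ord0 (widen_ord (leqnSn r) j) * (a ord0 i * B j i))); last first.
        by move=> i _; rewrite mulrN mulr_sumr; congr (- _);
          apply: eq_bigr => j _; rewrite mulrCA.
      rewrite sumrN exchange_big /=; congr (- _).
      by apply: eq_bigr => j _; rewrite mulr_sumr.
    by rewrite big1 ?oppr0// => j _; rewrite aBj mulr0.
  by move/eqP: E; rewrite mulf_eq0 (negPf vf) orbF => /eqP.
have u0 : \row_(j < r) u ord0 (widen_ord (leqnSn r) j) = 0.
  apply: (row_free_inj fg); rewrite mul0mx; apply/rowP => i.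
  rewrite mxE [RHS]mxE -[RHS](uE i) ur mul0r addr0.
  by apply: eq_bigr => j _; rewrite mxE.
apply/rowP => j; rewrite [RHS]mxE.
have [jr|jr] := ltnP j r.
  have := congr1 (fun A : 'rV[R]_r => A ord0 (Ordinal jr)) u0; rewrite !mxE => E.
  by rewrite -[RHS]E; congr (u _ _); apply: val_inj.
rewrite -[RHS]ur; congr (u _ _); apply: val_inj => /=.
by apply/eqP; rewrite eqn_leq jr andbT -ltnS.
Qed.

(** The coefficients in a frame are given by Cramer's rule from the values on
    functions separating the frame, hence are smooth. *)
Lemma frame_coeff w X p : open w -> w p -> vsec F w X ->
  exists w' (E : 'I_k -> vfield M) (a : 'I_k -> M -> R^o),
  [/\ open w', w' p, w' `<=` w, forall i, vsec F w' (E i) &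
   [/\ forall i, smooth_on w' (a i),
      forall q, w' q -> X q = \sum_i a i q *: E i q &
      X p = 0 -> forall i, a i p = 0]].
Proof.
move=> ow wp vX; have [w0 [E [ow0 w0p sE HE]]] := fol_frame F p.
have vE i : vsec F w0 (E i).
  split=> // q w0q; have [-> _] := HE q w0q.
  exists (fun j => (j == i)%:R); rewrite (bigD1 i)//= eqxx scale1r big1 ?addr0//.
  by move=> j /negPf ->; rewrite scale0r.
have [g sg] := dual_functions (fun i => vsec_tan (vE i) w0p) (HE p w0p).2.
set B0 := (X in X \in _) => unitB.
have [w1 [ow1 w1p sg1]] : exists w1, [/\ open w1, w1 p &
    forall j : 'I_k, smooth_on w1 (g j)].
  suff Hm m : exists w1, [/\ open w1, w1 p &
      forall j, (j < m)%N -> smooth_on w1 (g j)].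
    have [w1 [ow1 w1p H]] := Hm k; exists w1; split=> // j; exact: H.
  elim: m => [|m [w1 [ow1 w1p H]]]; first by exists setT; split=> //; exact: openT.
  have [w2 [ow2 w2p sg2]] := sg m; exists (w1 `&` w2); split=> //; first exact: openI.
  move=> j; rewrite ltnS leq_eqVlt => /orP[/eqP->|jm].
    by apply: smooth_onS sg2 => q [].
  by apply: smooth_onS (H j jm) => q [].
pose w2 := w `&` (w0 `&` w1).
have ow2 : open w2 by do !apply: openI.
pose B q : 'M[R]_k := \matrix_(j, i) (E i q (g j) : R).
have sB j i : smooth_on w2 (fun q => B q j i).
  have : smooth_on w2 (fun q => E i q (g j)).
    case: (sE i) => _; apply => //; first by move=> q [_ []].
    by apply: smooth_onS (sg1 j) => q [_ []].
  by apply: smooth_on_ext => // q _; rewrite mxE.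
have sdet := smooth_on_det ow2 sB.
pose w' := w2 `&` [set q | \det (B q) != 0].
have ow' : open w' by exact: smooth_on_neq0 sdet.
have sX j : (j < k)%N -> smooth_on w' (fun q => X q (g j)).
  move=> jk; case: vX => -[_ sX] _; apply: sX => //; first by move=> q [[]].
  by apply: smooth_onS (sg1 (Ordinal jk)) => q [[_ []]].
pose a i q : R^o := (\det (B q))^-1 * \sum_j cofactor (B q) j i * X q (g j).
exists w', E, a; split=> //.
- split; first by [].
  by move: unitB; rewrite unitmxE unitfE.
- by move=> q [[]].
- by move=> i; apply: vsecS (vE i) => q [[_ []]].
split.
- move=> i; apply: smooth_on_mul => //.
    apply: smooth_on_inv => //; first by move=> q [].
    by apply: smooth_onS sdet => q [].
  apply: smooth_on_sum => // j; apply: smooth_on_mul => //; last exact: sX.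
  apply: smooth_on_mul => //; first exact: smooth_on_cst.
  apply: smooth_on_det => // j' i'.
  have : smooth_on w' (fun q => B q (lift j j') (lift i i')).
    by apply: smooth_onS (sB _ _) => q [].
  by apply: smooth_on_ext => // q _; rewrite !mxE.
- move=> q [[wq [w0q w1q]] dq].
  case: vX => _ /(_ q wq); have [-> _] := HE q w0q => -[b Xb].
  rewrite Xb; apply: eq_bigr => i _; congr (_ *: _).
  rewrite /a; have -> : \sum_j cofactor (B q) j i * X q (g j) =
      (\adj (B q) *m B q *m \col_l b l) i ord0.
    rewrite -mulmxA mxE; apply: eq_bigr => j _.
    rewrite [\adj _ _ _]mxE; congr (_ * _); rewrite Xb sum_tvecE mxE.
    by apply: eq_bigr => l _; rewrite !mxE mulrC.
  by rewrite mul_adj_mx mul_scalar_mx !mxE mulrA mulVf// mul1r.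
- move=> Xp i; rewrite /a Xp big1 ?mulr0// => j _.
  by rewrite -[(0 : tvec M) _]/(0 : R) mulr0.
Qed.

End Frames.

(** * The vertical differential *)

Section Differential.
Local Arguments del : simpl never.
Context {R : realType} {n k : nat} {M : manifold R n} (F : foliation M k).
Implicit Types (u w : set M) (p : M) (f g : M -> R^o) (X Y Z : vfield M).
Implicit Types (o : preform M).

Lemma vform_mform u q o w : vform F u q o -> open w -> w `<=` u -> mform F w o.
Proof.
move=> [_ h2 h3 h4] ow wu; split.
- by move=> p s1 s2 a v v' /wu; exact: h2.
- by move=> p s1 s2 v _; exact: (h3 p s1 [::]).
- by move=> w' Xs ow' w'w vXs; apply: h4 => // x /w'w /wu.
Qed.

Lemma mformS w w' o : w' `<=` w -> mform F w o -> mform F w' o.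
Proof.
move=> w'w [h1 h2 h3]; split.
- by move=> q t1 t2 b v v' /w'w; exact: h1.
- by move=> q t1 t2 v /w'w; exact: h2.
- by move=> w2 Xs ow2 w2w; apply: h3 => // q /w2w /w'w.
Qed.

Lemma vsecsS w w' Xs : w' `<=` w -> vsecs F w Xs -> vsecs F w' Xs.
Proof. by move=> ww' vXs X /vXs; exact: vsecS. Qed.

Lemma del_cons (T : Type) i (x : T) s : del i.+1 (x :: s) = x :: del i s.
Proof. by []. Qed.

Lemma del0 (T : Type) (x : T) s : del 0 (x :: s) = s.
Proof. by rewrite /del /= drop0. Qed.

(** Moving [[X, Y_j]] from position [j] to the front of the list gives the sign. *)
Lemma Lie_expand w o X Ys p : open w -> mform F w o -> vsec F w X -> vsecs F w Ys ->
  w p -> Lie X (ev o) Ys p = X p (ev o Ys) -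
    \sum_(j < size Ys) (-1) ^+ j * ev o (bracket X Ys`_j :: del j Ys) p.
Proof.
move=> ow + vX + wp; elim: Ys o => [|Y Ys IH] o mo.
  by move=> _; rewrite big_ord0 subr0.
move=> /vsecs_cons[vY vYs]; rewrite /= iprod_ev IH//; last exact: mform_contr.
rewrite big_ord_recl /= expr0 mul1r del0 opprD addrA addrAC.
congr (_ + - _ - _); apply: eq_bigr => j _.
rewrite /bump leq0n add1n add0n exprS mulN1r mulNr -mulrN; congr (_ * _).
rewrite del_cons; apply: (@ev_swap _ _ _ _ F w o [::]) => //.
by apply: vsec_bracket => //; apply: vYs; exact: mem_nth.
Qed.

(** Separating the terms of Cartan's formula that involve the first field as a
    derivation or in a bracket, which form its Lie derivative, from the others. *)
Lemma cartan_CE w o Xs p : open w -> mform F w o -> vsecs F w Xs -> w p ->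
  cartan o Xs p = CE (ev o) Xs p.
Proof.
move=> ow + + wp; elim: Xs o => [|X Xs IH] o mo.
  by rewrite /cartan !big_ord0 addr0.
move=> /vsecs_cons[vX vXs]; rewrite /= iprod_ev -IH//; last exact: mform_contr.
rewrite (Lie_expand ow mo vX vXs wp) /cartan /= !big_ord_recl /= big_ord0 add0r.
rewrite expr0 scale1r del0 opprD -!addrA; congr (_ + _).
rewrite [RHS]addrCA; congr (_ + _).
  by rewrite -sumrN; apply: eq_bigr => i _; rewrite /bump leq0n add1n exprS mulN1r scaleNr.
rewrite -!sumrN -big_split /=; apply: eq_bigr => j _.
rewrite /bump leq0n add1n add0n big_ord_recl /= add0n.
rewrite exprS mulN1r scaleNr; congr (_ + _).
  by rewrite [X in del 0 X]del_cons del0.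
have sN m (G : 'I_m -> R^o) : - (\sum_(i < m) G i) = \sum_(i < m) - G i.
  by rewrite sumrN.
apply: etrans (esym (sN _ _)); apply: eq_bigr => i _.
rewrite /bump leq0n add1n add0n addSn addnS !exprS !mulN1r opprK -scalerN.
congr (_ *: _).
apply: (@ev_swap _ _ _ _ F w o [::] (del i (del j Xs)) (bracket Xs`_i Xs`_j)) => //.
have ji : (j < size Xs)%N by [].
have ii : (i < size Xs)%N by exact: ltn_trans (ltn_ord i) ji.
by apply: vsec_bracket => //; apply: vXs; exact: mem_nth.
Qed.

(** In a frame, [X = \sum_i a_i E_i] with [a_i p = 0], and the differential is linear
    over functions. *)
Lemma CE_value w o s1 s2 X p : open w -> mform F w o -> w p -> vsec F w X ->
  vsecs F w s1 -> vsecs F w s2 -> X p = 0 -> CE (ev o) (s1 ++ X :: s2) p = 0.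
Proof.
move=> ow mo wp vX vs1 vs2 Xp.
have [w' [E [a [ow' w'p w'w vE [sa EX ap]]]]] := frame_coeff ow wp vX.
have mo' := mformS w'w mo.
pose Z (t : seq 'I_k) : vfield M := fun q => \sum_(i <- t) a i q *: E i q.
have vs1' := vsecsS w'w vs1; have vs2' := vsecsS w'w vs2.
have HZ t : vsec F w' (Z t) /\ CE (ev o) (s1 ++ Z t :: s2) p = 0.
  elim: t => [|i t [vZ CZ]].
    have vZ : vsec F w' (Z [::]).
      by apply: vsec_ext (vsec0 _ _) => q _; rewrite /Z big_nil.
    split=> //.
    have E0 q : w' q -> Z [::] q = 1 *: Z [::] q + Z [::] q.
      by move=> _; rewrite /Z big_nil scaler0 addr0.
    have := CE_tensor ow' (smooth_on_cst _ 1) vZ vZ E0 mo' vs1' vs2' w'p.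
    by rewrite mul1r => /eqP; rewrite -subr_eq subrr eq_sym => /eqP.
  have Ei q : w' q -> Z (i :: t) q = a i q *: E i q + Z t q.
    by move=> _; rewrite /Z big_cons.
  split; first by apply: vsec_tensor Ei.
  rewrite (CE_tensor ow' (sa i) (vE i) vZ Ei mo' vs1' vs2' w'p).
  by rewrite ap// mul0r CZ addr0.
(* The coefficient 0 in [CE_tensor] replaces [X] by its expansion, which agrees with
   it on [w'] only. *)
have [vZ CZ] := HZ (index_enum 'I_k); have vX' := vsecS w'w vX.
have EZ q : w' q -> X q = 0 *: X q + Z (index_enum 'I_k) q.
  by move=> /EX ->; rewrite scale0r add0r.
rewrite (CE_tensor ow' (smooth_on_cst _ 0) vX' vZ EZ mo' vs1' vs2' w'p).
by rewrite mul0r CZ addr0.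
Qed.

(** The value at [p] of the differential depends on the values of the fields at
    [p] only, so that it can be computed with any extensions of the arguments. *)
Lemma CE_pointwise w o Xs Ys p : open w -> mform F w o -> w p ->
  vsecs F w Xs -> vsecs F w Ys -> [seq X p | X <- Xs] = [seq Y p | Y <- Ys] ->
  CE (ev o) Xs p = CE (ev o) Ys p.
Proof.
move=> ow mo wp.
suff H s1 : vsecs F w s1 -> vsecs F w Xs -> vsecs F w Ys ->
    [seq X p | X <- Xs] = [seq Y p | Y <- Ys] ->
    CE (ev o) (s1 ++ Xs) p = CE (ev o) (s1 ++ Ys) p by exact: (H [::]).
elim: Xs Ys s1 => [|X Xs IH] [|Y Ys] s1 //= vs1 /vsecs_cons[vX vXs]
  /vsecs_cons[vY vYs] [XY EYs].
pose D : vfield M := fun q => -1 *: Y q + X q.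
have vD : vsec F w D by apply: vsec_lin => //; exact: smooth_on_cst.
have ED q : w q -> X q = 1 *: D q + Y q.
  by move=> _; rewrite /D scale1r scaleN1r addrC addrA subrr add0r.
rewrite (CE_tensor ow (smooth_on_cst _ 1) vD vY ED mo vs1 vXs wp).
have Dp : D p = 0 by rewrite /D XY scaleN1r addNr.
rewrite (CE_value ow mo wp vD vs1 vXs Dp) mulr0 add0r.
rewrite -!cat_rcons; apply: IH => // Z; rewrite mem_rcons inE.
by move=> /orP[/eqP->|/vs1].
Qed.

Lemma CE_swap w o s1 s2 X Y p : open w -> mform F w o -> w p ->
  vsec F w X -> vsec F w Y -> vsecs F w s1 -> vsecs F w s2 ->
  CE (ev o) (s1 ++ X :: Y :: s2) p = - CE (ev o) (s1 ++ Y :: X :: s2) p.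
Proof.
move=> ow mo wp vX vY vs1 vs2.
pose W : vfield M := fun q => 1 *: X q + Y q.
have s11 := @smooth_on_cst _ _ M w 1.
have vW : vsec F w W by exact: vsec_lin.
have EW q : w q -> W q = 1 *: X q + Y q by [].
have vWs : vsecs F w (W :: s2) by apply/vsecs_cons.
have r Z : vsec F w Z -> vsecs F w (rcons s1 Z).
  by move=> vZ V; rewrite mem_rcons inE => /orP[/eqP->|/vs1].
have := CE_alt_adj ow mo vW vs1 vs2 wp.
rewrite (CE_tensor ow s11 vX vY EW mo vs1 vWs wp) -!(cat_rcons _ _ (W :: s2)).
rewrite !(CE_tensor ow s11 vX vY EW mo (r _ _) vs2 wp)// !cat_rcons.
rewrite !(CE_alt_adj ow mo _ vs1 vs2 wp)// !mul1r add0r addr0.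
by move=> /eqP; rewrite addr_eq0 => /eqP.
Qed.

Lemma CE_alt w o s1 s2 s3 X p : open w -> mform F w o -> w p ->
  vsec F w X -> vsecs F w s1 -> vsecs F w s2 -> vsecs F w s3 ->
  CE (ev o) (s1 ++ X :: s2 ++ X :: s3) p = 0.
Proof.
move=> ow mo wp vX + + vs3.
elim: s2 s1 => [|Y s2 IH] s1 vs1 vs2; first exact: (CE_alt_adj ow mo).
have [vY vs2'] := (vsecs_cons _ _ _ _).1 vs2.
rewrite cat_cons (CE_swap ow mo wp)//; last first.
  by apply/vsecs_cat; split=> //; apply/vsecs_cons.
rewrite -cat_rcons IH ?oppr0// => V.
by rewrite mem_rcons inE => /orP[/eqP->|/vs1].
Qed.

(** Degrees are tracked as vanishing of a cochain on the lists of length [m]. *)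
Lemma Lie_size w m c X Ys p : open w -> vsec F w X -> w p ->
  (forall Zs q, vsecs F w Zs -> size Zs = m -> w q -> c Zs q = 0) ->
  vsecs F w Ys -> size Ys = m -> Lie X c Ys p = 0.
Proof.
move=> ow vX wp; elim: Ys m c => [|Y Ys IH] m c Hc.
  move=> _ m0; rewrite /= -(tvec0 (vsec_tan vX wp)).
  apply: (tvec_germ (vsec_tan vX wp)); apply: (near_open ow wp) => q wq.
  exact: Hc.
case: m Hc => // m Hc /vsecs_cons[vY vYs] [sYs] /=.
rewrite (IH m)// => [|Zs q vZs sZs wq].
  rewrite Hc ?subr0//=; last by rewrite sYs.
  by apply/vsecs_cons; split=> //; exact: vsec_bracket.
by rewrite /iprod Hc//=; [apply/vsecs_cons|rewrite sZs].
Qed.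

Lemma CE_size w m c Ys p : open w -> w p ->
  (forall Zs q, vsecs F w Zs -> size Zs = m -> w q -> c Zs q = 0) ->
  vsecs F w Ys -> size Ys = m.+1 -> CE c Ys p = 0.
Proof.
move=> ow wp; elim: Ys m c => [//|Y Ys IH] m c Hc /vsecs_cons[vY vYs] [sYs] /=.
rewrite (Lie_size ow vY wp Hc)// sub0r; apply/eqP; rewrite oppr_eq0; apply/eqP.
case: m Hc sYs => [|m] Hc sYs; first by case: Ys sYs {IH vYs}.
apply: (IH m) => // Zs q vZs sZs wq.
by rewrite /iprod Hc//=; [apply/vsecs_cons|rewrite sZs].
Qed.

Lemma extend_val p (v : tvec M) : fol_dist F p v -> extend F p v p = v.
Proof.
move=> Vv; rewrite /extend; set P := (X in xget 0 X).
suff [X PX] : exists X, P X by have [] := xgetPex 0 (ex_intro _ X PX).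
have [w [E [ow wp sE HE]]] := fol_frame F p.
have vE i : vsec F w (E i).
  split=> // q wq; have [-> _] := HE q wq.
  exists (fun j => (j == i)%:R); rewrite (bigD1 i)//= eqxx scale1r big1 ?addr0//.
  by move=> j /negPf ->; rewrite scale0r.
have [EV _] := HE p wp; move: Vv; rewrite EV => -[a va].
exists (fun q => \sum_i a i *: E i q); split; first by rewrite va.
exists w; split=> //.
elim: (index_enum _) => [|i t IH].
  by apply: vsec_ext (vsec0 _ _) => q _; rewrite big_nil.
apply: vsec_ext (vsec_lin ow (smooth_on_cst _ (a i)) (vE i) IH) => q _.
by rewrite big_cons.
Qed.

Lemma map_extend p s : (forall v, v \in s -> fol_dist F p v) ->
  [seq X p | X <- [seq extend F p v | v <- s]] = s.
Proof.
move=> H; rewrite -map_comp map_id_in// => v vs.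
by rewrite /= extend_val//; exact: H.
Qed.

Lemma vsecs_dist w Xs p : vsecs F w Xs -> w p ->
  forall v, v \in [seq X p | X <- Xs] -> fol_dist F p v.
Proof. by move=> vXs wp v /mapP[X XXs ->]; case: (vXs _ XXs) => _; apply. Qed.

Section OneForm.
Variables (u : set M) (q : nat) (o : preform M).
Hypotheses (ou : open u) (fo : vform F u q o).

(** By [CE_pointwise], applied to the extensions chosen in the definition of [dF]. *)
Lemma dF_CE w Xs p : open w -> w `<=` u -> w p -> vsecs F w Xs ->
  dF F u o p [seq X p | X <- Xs] = CE (ev o) Xs p.
Proof.
move=> ow wu wp vXs; have up := wu p wp.
have Vs := vsecs_dist vXs wp.
rewrite /dF asboolT//.
have [w1 [ow1 w1p w1u ve]] := extend_vsecs F [seq X p | X <- Xs] ou up.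
rewrite (cartan_CE ow1 (vform_mform fo ow1 w1u) ve w1p).
have ow2 := openI ow1 ow; have w21 : w1 `&` w `<=` w1 by move=> x [].
have w2w : w1 `&` w `<=` w by move=> x [].
apply: (CE_pointwise ow2) => //.
- by apply: vform_mform fo ow2 _ => x [/w1u].
- exact: vsecsS ve.
- exact: vsecsS vXs.
- exact: map_extend.
Qed.

Lemma dF_vform : vform F u q.+1 (dF F u o).
Proof.
have ext p s : u p -> (forall v, v \in s -> fol_dist F p v) ->
    exists w Xs, [/\ open w, w `<=` u, w p, vsecs F w Xs & s = [seq X p | X <- Xs]].
  move=> up Vs; have [w [ow wp wu ve]] := extend_vsecs F s ou up.
  by exists w, [seq extend F p v | v <- s]; split=> //; rewrite map_extend.
have dF0 p s : ~ (u p /\ forall v, v \in s -> fol_dist F p v) -> dF F u o p s = 0.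
  by move=> H; rewrite /dF asboolF.
split.
- move=> p s H.
  have [[up Vs]|nu] := pselect (u p /\ forall v, v \in s -> fol_dist F p v); last exact: dF0.
  have [w [Xs [ow wu wp vXs sE]]] := ext p s up Vs.
  rewrite sE (dF_CE ow wu wp vXs).
  have sq : size Xs <> q.+1.
    by move=> sXs; apply: H; split=> //; rewrite sE size_map.
  case: Xs sE vXs sq => [//|X Xs] sE vXs sq.
  apply: (@CE_size w (size Xs)) => // Zs x vZs sZs wx.
  have [h1 _ _ _] := fo; apply: h1 => -[_ ss _]; apply: sq.
  by rewrite /= -sZs -ss size_map.
- move=> p s1 s2 a v v' up Vv Vv'.
  have [Vs|nVs] := pselect (forall x, x \in s1 ++ s2 -> fol_dist F p x); last first.
    have N x : ~ (u p /\ forall y, y \in s1 ++ x :: s2 -> fol_dist F p y).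
      move=> [_ Vx]; apply: nVs => y; rewrite mem_cat => ys; apply: Vx.
      by rewrite mem_cat inE; case/orP: ys => ->; rewrite ?orbT.
    by rewrite !dF0 ?scaler0 ?addr0//; exact: N.
  have Vt x : x \in s1 ++ v :: v' :: s2 -> fol_dist F p x.
    rewrite mem_cat !inE => /or4P[xs|/eqP->|/eqP->|xs] //; apply: Vs.
      by rewrite mem_cat xs.
    by rewrite mem_cat xs orbT.
  have [w [ow wp wu ve]] := extend_vsecs F (s1 ++ v :: v' :: s2) ou up.
  rewrite map_cat /= in ve.
  move: ve => /vsecs_cat[ve1 /vsecs_cons[vX /vsecs_cons[vX' ve2]]].
  have V1 x : x \in s1 -> fol_dist F p x by move=> xs; apply: Vs; rewrite mem_cat xs.
  have V2 x : x \in s2 -> fol_dist F p x by move=> xs; apply: Vs; rewrite mem_cat xs orbT.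
  rewrite -(map_extend V1) -(map_extend V2).
  set e1 := [seq extend F p x | x <- s1] in ve1 *.
  set e2 := [seq extend F p x | x <- s2] in ve2 *.
  set X := extend F p v in vX *; set X' := extend F p v' in vX' *.
  have Xp : X p = v by exact: extend_val.
  have X'p : X' p = v' by exact: extend_val.
  pose W : vfield M := fun x => a *: X x + X' x.
  have sa := @smooth_on_cst _ _ M w a.
  have vW : vsec F w W by exact: vsec_lin.
  have EW x : w x -> W x = a *: X x + X' x by [].
  have E Y y : Y p = y -> vsec F w Y ->
      dF F u o p ([seq X p | X <- e1] ++ y :: [seq X p | X <- e2]) =
      CE (ev o) (e1 ++ Y :: e2) p.
    move=> <- vY; rewrite -(dF_CE ow wu wp) ?map_cat//.
    by apply/vsecs_cat; split=> //; apply/vsecs_cons.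
  rewrite (E W)//; last by rewrite /W Xp X'p.
  rewrite (E X)// (E X')//.
  by rewrite (CE_tensor ow sa vX vX' EW (vform_mform fo ow wu) ve1 ve2 wp).
- move=> p s1 s2 s3 v.
  have [[up Vs]|nu] := pselect (u p /\
    forall y, y \in s1 ++ v :: s2 ++ v :: s3 -> fol_dist F p y);
    last exact: dF0.
  have [w [ow wp wu ve]] := extend_vsecs F (s1 ++ v :: s2 ++ v :: s3) ou up.
  rewrite -(map_extend Vs) (dF_CE ow wu wp ve).
  rewrite map_cat /= map_cat /= in ve *.
  move: ve => /vsecs_cat[ve1 /vsecs_cons[vX /vsecs_cat[ve2 /vsecs_cons[_ ve3]]]].
  exact: (CE_alt ow (vform_mform fo ow wu)).
- move=> w Xs ow wu vXs.
  apply: smooth_on_ext (smooth_CE ow (smooth_ev ow (vform_mform fo ow wu)) vXs) => // x wx.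
  by rewrite (dF_CE ow wu wx vXs).
Qed.

End OneForm.

Lemma dF_dF u q o : open u -> vform F u q o -> dF F u (dF F u o) = 0.
Proof.
move=> ou fo; have fd := dF_vform ou fo.
apply/funext => p; apply/funext => s.
change (dF F u (dF F u o) p s = 0).
have [[up Vs]|nu] := pselect (u p /\ forall v, v \in s -> fol_dist F p v); last first.
  by rewrite /dF asboolF.
have [w [ow wp wu ve]] := extend_vsecs F s ou up.
rewrite -(map_extend Vs) (dF_CE ou fd ow wu wp ve).
rewrite (CE_eqc ow (c' := CE (ev o)) _ ve wp); last first.
  by move=> Ys x vYs wx; exact: (dF_CE ou fo ow wu wx vYs).
exact: (CE_CE ow (vform_mform fo ow wu) ve wp).
Qed.

Lemma restr_in w o p s : w p -> restr w o p s = o p s.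
Proof. by move=> wp; rewrite /restr asboolT. Qed.

Lemma restr_out w o p s : ~ w p -> restr w o p s = 0.
Proof. by move=> wp; rewrite /restr asboolF. Qed.

Lemma restr_vform u w q o : open w -> w `<=` u -> vform F u q o ->
  vform F w q (restr w o).
Proof.
move=> ow wu [h1 h2 h3 h4]; split.
- move=> p s H; have [wp|nwp] := pselect (w p); last by rewrite restr_out.
  by rewrite restr_in// h1// => -[_ ss Vs]; apply: H.
- by move=> p s1 s2 a v v' wp Vv Vv'; rewrite !restr_in// h2//; exact: wu.
- move=> p s1 s2 s3 v.
  by have [wp|nwp] := pselect (w p); [rewrite restr_in|rewrite restr_out].
- move=> w' Xs ow' w'w vXs; apply: smooth_on_ext (h4 w' Xs ow' _ vXs) => //.
    by move=> p w'p; rewrite restr_in//; exact: w'w.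
  by move=> p /w'w /wu.
Qed.

(** Both sides are values of [CE] on germs at points of [w], where [o] and its
    restriction agree. *)
Lemma dF_restr u w q o : open u -> open w -> w `<=` u -> vform F u q o ->
  dF F w (restr w o) = restr w (dF F u o).
Proof.
move=> ou ow wu fo; have fr := restr_vform ow wu fo.
apply/funext => p; apply/funext => s.
have [wp|nwp] := pselect (w p); last first.
  by rewrite restr_out// /dF asboolF// => -[].
rewrite restr_in//.
have [Vs|nVs] := pselect (forall v, v \in s -> fol_dist F p v); last first.
  by rewrite /dF !asboolF// => -[].
have [w' [ow' w'p w'w ve]] := extend_vsecs F s ow wp.
have w'u : w' `<=` u by move=> x /w'w /wu.
rewrite -(map_extend Vs) (dF_CE ow fr ow' w'w w'p ve) (dF_CE ou fo ow' w'u w'p ve).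
apply: (CE_eqc ow' _ ve w'p) => Ys x vYs w'x.
by rewrite /ev restr_in//; exact: w'w.
Qed.

Lemma dF0 u : open u -> dF F u 0 = 0.
Proof.
move=> ou; have := dF_lin 1 ou (vform0 F u 0) (vform0 F u 0).
rewrite !scale1r addr0 => /eqP; rewrite -subr_eq subrr eq_sym => /eqP ->.
by [].
Qed.

End Differential.

(** * Gluing vertical forms *)

Section GluingForms.
Context {R : realType} {n k : nat} {M : manifold R n} (F : foliation M k).
Implicit Types (u w : set M) (p : M) (f : M -> R^o) (o t : preform M).

Lemma vform_opp u q o : vform F u q o -> vform F u q (- o).
Proof.
move=> fo; have := vform_lin (-1) fo (vform0 F u q).
by rewrite scaleN1r addr0.
Qed.

Lemma vform_add u q o o' : vform F u q o -> vform F u q o' -> vform F u q (o + o').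
Proof. by move=> fo fo'; rewrite -(scale1r o); exact: vform_lin. Qed.

Lemma vform_scale u q (a : R) o : vform F u q o -> vform F u q (a *: o).
Proof. by move=> fo; rewrite -[_ *: _]addr0; apply: vform_lin => //; exact: vform0. Qed.

Lemma vform_sum u q I (r : seq I) (t : I -> preform M) :
  (forall i, vform F u q (t i)) -> vform F u q (\sum_(i <- r) t i).
Proof.
move=> ft; elim: r => [|i r IH]; first by rewrite big_nil; exact: vform0.
by rewrite big_cons; exact: vform_add.
Qed.

Lemma sum_preformE I (r : seq I) (t : I -> preform M) p s :
  (\sum_(i <- r) t i) p s = \sum_(i <- r) t i p s.
Proof. by rewrite !fct_sumE. Qed.

Lemma vform_local u q o : (forall p s, ~ u p -> o p s = 0) ->
  (forall p, u p -> exists w z, [/\ open w, w p, vform F u q z &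
    forall p', w p' -> o p' = z p']) -> vform F u q o.
Proof.
move=> o0 H; split.
- move=> p s nH; have [up|] := pselect (u p); last exact: o0.
  by have [w [z [_ wp [h1 _ _ _] E]]] := H p up; rewrite E// h1.
- move=> p s1 s2 a v v' up Vv Vv'.
  by have [w [z [_ wp [_ h2 _ _] E]]] := H p up; rewrite E// h2.
- move=> p s1 s2 s3 v; have [up|] := pselect (u p); last exact: o0.
  by have [w [z [_ wp [_ _ h3 _] E]]] := H p up; rewrite E// h3.
- move=> w' Xs ow' w'u vXs; apply: smooth_on_local => p w'p.
  have [w [z [ow wp [_ _ _ h4] E]]] := H p (w'u p w'p).
  have oi := openI ow' ow; exists (w' `&` w) => //.
  apply: (smooth_on_ext (f := fun p => z p [seq X p | X <- Xs])) => //.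
    by move=> x [_ wx]; rewrite E.
  apply: h4 => //; first by move=> x [/w'u].
  by apply: vsecsS vXs => x [].
Qed.

(** Near a point of [S] this is a product of smooth functions, and near any other
    point it is zero because [S] is closed. *)
Lemma vform_extend u V S q f t : open u -> open V -> smooth_on setT f ->
  closed S -> S `<=` V -> (forall p, ~ S p -> f p = 0) ->
  vform F (V `&` u) q t -> vform F u q (fun p s => f p * t p s).
Proof.
move=> ou oV sf cS SV f0 [h1 h2 h3 h4]; split.
- by move=> p s H; rewrite h1 ?mulr0// => -[[_ up] ss Vs]; apply: H.
- move=> p s1 s2 a v v' up Vv Vv'.
  have [Vp|nVp] := pselect (V p).
    by rewrite h2// mulrDr; congr (_ + _); rewrite /GRing.scale /=; ring.
  by rewrite f0 ?mul0r ?scaler0 ?addr0// => /SV.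
- by move=> p s1 s2 s3 v; rewrite h3 mulr0.
- move=> w' Xs ow' w'u vXs; apply: smooth_on_local => p w'p.
  have [Sp|nSp] := pselect (S p).
    have oi := openI ow' oV; exists (w' `&` V); first by split=> //; exact: SV.
    apply: smooth_on_mul => //; first by apply: smooth_onS sf.
    apply: h4 => //; first by move=> x [/w'u ? ?].
    by apply: vsecsS vXs => x [].
  have oi := openI ow' (closed_openC cS); exists (w' `&` ~` S) => //.
  apply: (smooth_on_ext (f := fun=> 0)) => //; last exact: smooth_on_cst.
  by move=> x [_ Sx]; rewrite f0// mul0r.
Qed.

Lemma sum_ord_vanish (V : nmodType) (t : nat -> V) m l :
  (forall i, (m <= i)%N -> t i = 0) -> (forall i, (l <= i)%N -> t i = 0) ->
  \sum_(i < m) t i = \sum_(i < l) t i.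
Proof.
wlog ml : m l / (m <= l)%N.
  by move=> H; case: (leqP m l) => [|/ltnW] ml tm tl; [|symmetry]; exact: H.
move=> tm _; rewrite -!(big_mkord predT t) (big_cat_nat (leq0n m) ml) /=.
by rewrite [X in _ = _ + X]big_nat [X in _ = _ + X]big1 ?addr0// => i /andP[/tm].
Qed.

End GluingForms.

(** * Exactness of the rows *)

Section CechAlgebra.
Context {R : realType} {n : nat} {M : manifold R n}.
Context {d : Order.disp_t} {A : orderType d}.
Implicit Types (a b : A) (s t : seq A).
Local Notation cochainA := (@cech_cochain R n M d A : Type).
Local Arguments del : simpl never.

(** The simplicial coboundary, without restrictions to intersections: [cech_delta] is
    its restriction, by [cech_delta_cobd]. *)
Definition cobd (x : cochainA) : cochainA := fun s =>
  \sum_(i < size s) (-1) ^+ i *: x (del i s).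

(** The cone over the vertex [a]: up to sign, the value at the increasing list
    obtained by inserting [a] into [s], or 0 if [a] occurs in [s]. *)
Fixpoint cone a (x : cochainA) (s : seq A) {struct s} : preform M :=
  if s is b :: s' then
    if (a < b)%O then x (a :: s) else if a == b then 0
    else - cone a (fun t => x (b :: t)) s'
  else x [:: a].

Lemma cobd_cons (x : cochainA) b s : cobd x (b :: s) = x s - cobd (fun t => x (b :: t)) s.
Proof.
rewrite /cobd big_ord_recl expr0 scale1r del0 -sumrN; congr (_ + _).
by apply: eq_bigr => i _; rewrite lift0 exprS mulN1r scaleNr del_cons.
Qed.

Lemma cobd_eq (x y : cochainA) s :
  (forall i, (i < size s)%N -> x (del i s) = y (del i s)) -> cobd x s = cobd y s.
Proof. by move=> H; apply: eq_bigr => i _; rewrite H. Qed.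

Lemma cobdN (x : cochainA) s : cobd (fun t => - x t) s = - cobd x s.
Proof. by rewrite /cobd -sumrN; apply: eq_bigr => i _; rewrite scalerN. Qed.

Lemma cobd0 s : cobd (fun=> 0) s = 0.
Proof. by rewrite /cobd big1// => i _; rewrite scaler0. Qed.

Lemma coneB a (x y : cochainA) s : cone a (fun t => x t - y t) s = cone a x s - cone a y s.
Proof.
elim: s x y => [//|b s IH] x y /=; case: ifP => // _; case: ifP => _.
  by rewrite subrr.
by rewrite IH opprB opprK addrC.
Qed.

Lemma cone_lt a (x : cochainA) s : all (fun b => (a < b)%O) s -> cone a x s = x (a :: s).
Proof. by case: s => [//|b s] /= /andP[-> _]. Qed.

Lemma all_del (T : Type) (P : pred T) i (s : seq T) : all P s -> all P (del i s).
Proof.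
move=> Ps; rewrite all_cat; have := Ps; rewrite -{1}(cat_take_drop i s) all_cat => /andP[-> _].
by have := Ps; rewrite -{1}(cat_take_drop i.+1 s) all_cat => /andP[_ ->].
Qed.

Lemma sorted_ltP b s : sorted <%O (b :: s) -> all (fun c => (b < c)%O) s /\ sorted <%O s.
Proof.
move=> sbs; split; last exact: path_sorted sbs.
by rewrite /= (path_sortedE lt_trans) in sbs; case/andP: sbs.
Qed.

(** The coboundary of the cone is computed by the same recursion on the list as
    [cone] itself; when [b < a] the two terms [cone a x s] cancel, and the rest is
    the homotopy formula for [x] contracted with [b]. *)
Lemma cone_homotopy a (x : cochainA) s : sorted <%O s ->
  cobd (cone a x) s + cone a (cobd x) s = x s.
Proof.
elim: s x => [|b s IH] x ss.
  by rewrite /= cobd_cons /cobd !big_ord0 add0r subr0.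
have [bs ss'] := sorted_ltP ss; rewrite /=; case: (ltgtP a b) => ab.
- have abs : all (fun c => (a < c)%O) (b :: s).
    by rewrite /= ab; apply: sub_all bs => c; exact: lt_trans.
  rewrite [cobd x _]cobd_cons.
  have -> : cobd (cone a x) (b :: s) = cobd (fun t => x (a :: t)) (b :: s).
    by apply: cobd_eq => i _; rewrite cone_lt//; exact: all_del.
  by rewrite addrC subrK.
- have E : cobd (fun t => cone a x (b :: t)) s =
      cobd (fun t => - cone a (fun t' => x (b :: t')) t) s.
    by apply: cobd_eq => i _ /=; rewrite lt_gtF// gt_eqF.
  rewrite cobd_cons E cobdN opprK -[RHS](IH (fun t => x (b :: t)) ss').
  have -> : (fun t => cobd x (b :: t)) = (fun t => x t - cobd (fun t' => x (b :: t')) t).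
    by apply/funext => t; rewrite cobd_cons.
  by rewrite coneB opprB [_ - cone a x s]addrC addrACA subrr add0r.
- subst b; have E : cobd (fun t => cone a x (a :: t)) s = cobd (fun=> 0) s.
    by apply: cobd_eq => i _ /=; rewrite ltxx eqxx.
  by rewrite cobd_cons E cobd0 subr0 addr0 cone_lt.
Qed.

(** For properties of forms that ignore signs, such as being a vertical form or
    vanishing, the cone is [x] at the list obtained by inserting [a]. *)
Lemma cone_ind a (P : preform M -> Prop) (x : cochainA) s : sorted <%O s ->
  P 0 -> (forall o, P o -> P (- o)) ->
  (forall t, sorted <%O t -> size t = (size s).+1 -> t =i a :: s -> P (x t)) ->
  P (cone a x s).
Proof.
move=> + P0 PN; elim: s x => [|b s IH] x ss Px; first exact: Px.
have [bs ss'] := sorted_ltP ss; rewrite /=; case: (ltgtP a b) => ab //.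
  by apply: Px => //; rewrite /= ab.
apply/PN/IH => // t st sizet tE; apply: Px => //=.
- rewrite (path_sortedE lt_trans) st andbT; apply/allP => c.
  by rewrite tE inE => /orP[/eqP->//|]; exact: (allP bs).
- by rewrite sizet.
- by move=> c; rewrite !inE tE inE orbCA.
Qed.

End CechAlgebra.

Section RowExact.
Context {R : realType} {n k : nat} {M : manifold R n} (F : foliation M k).
Context {d : Order.disp_t} {A : orderType d} (U : A -> set M).
Hypotheses (Uopen : forall a, open (U a)) (Ucover : \bigcup_a U a = [set: M]).
Implicit Types (a b : A) (s t : seq A).
Local Notation cochainA := (@cech_cochain R n M d A : Type).

Lemma cover_interP s p : cover_inter U s p <-> forall a, a \in s -> U a p.
Proof. by split=> H a; [apply: H | apply: H]. Qed.

Lemma cover_inter_sub s t : {subset s <= t} -> cover_inter U t `<=` cover_inter U s.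
Proof. by move=> st p /cover_interP H; apply/cover_interP => a /st /H. Qed.

Lemma cover_inter_eq s t : s =i t -> cover_inter U s = cover_inter U t.
Proof. by move=> st; apply/seteqP; split; apply: cover_inter_sub => a; rewrite st. Qed.

Lemma cover_inter_cons a s : cover_inter U (a :: s) = U a `&` cover_inter U s.
Proof.
apply/seteqP; split=> p.
  move=> /cover_interP H; split; first by apply: H; rewrite inE eqxx.
  by apply/cover_interP => b bs; apply: H; rewrite inE bs orbT.
move=> [Ua /cover_interP H]; apply/cover_interP => b.
by rewrite inE => /orP[/eqP->//|/H].
Qed.

Lemma cover_inter_nil : cover_inter U [::] = setT.
Proof. by apply/seteqP; split. Qed.

Lemma restr_sum w I (r : seq I) (t : I -> preform M) :
  restr w (\sum_(i <- r) t i) = \sum_(i <- r) restr w (t i).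
Proof.
apply/funext => p; apply/funext => s; rewrite sum_preformE.
have [wp|nwp] := pselect (w p).
  by rewrite restr_in// sum_preformE; apply: eq_bigr => i _; rewrite restr_in.
by rewrite restr_out// big1// => i _; rewrite restr_out.
Qed.

Lemma restr_scale w (a : R) (o : preform M) : restr w (a *: o) = a *: restr w o.
Proof.
apply/funext => p; apply/funext => s; change (restr w (a *: o) p s = a * restr w o p s).
have [wp|nwp] := pselect (w p); first by rewrite !restr_in.
by rewrite !restr_out// mulr0.
Qed.

Lemma cech_delta_cobd (x : cochainA) s :
  cech_delta U x s = if sorted <%O s then restr (cover_inter U s) (cobd x s) else 0.
Proof.
rewrite /cech_delta; case: ifP => // _; rewrite /cobd restr_sum.
by apply: eq_bigr => i _; rewrite restr_scale.
Qed.

(** Cochains on the increasing lists of [m] indices: the term of bidegree [(m - 1, q)] if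
    [0 < m], and the forms on [M], sitting at the empty list, if [m = 0]. *)
Definition aug_mem m q (x : cochainA) : Prop := forall s,
  if (size s == m) && sorted <%O s then vform F (cover_inter U s) q (x s)
  else x s = 0.

Lemma aug_mem0 m q : aug_mem m q 0.
Proof. by move=> s; case: ifP => // _; exact: vform0. Qed.

Lemma aug_vform m q (x : cochainA) s : aug_mem m q x ->
  vform F (cover_inter U s) q (x s).
Proof. by move/(_ s); case: ifP => // _ ->; exact: vform0. Qed.

(** The primitive is [\sum_i phi_i (cone a_i x)], where [phi_i] is supported in
    [U a_i]. Multiplication by [phi_i] commutes with the coboundary, and at points of
    [U a_i] the homotopy formula reduces to [cobd (cone a_i x) = x], since [cobd x]
    vanishes over the intersections. For [m = 0] this glues a family of forms that
    agree on the overlaps. *)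
Lemma row_exact m q (x : cochainA) : aug_mem m.+1 q x -> cech_delta U x = 0 ->
  exists2 y, aug_mem m q y & cech_delta U y = x.
Proof.
move=> mx dx.
have [[a0]|nA] := pselect (inhabited A); last first.
  have snil s : s = [::] by case: s => // a s; case: nA; split.
  exists 0; first exact: aug_mem0.
  apply/funext => s; rewrite (snil s) /cech_delta /= big_ord0.
  by have := mx [::].
have [phi [al [S [sphi cS SU phi0 fin]]]] := partition_of_unity a0 Uopen Ucover.
have {fin} /choice[N HN] : forall p, exists N, exists w, [/\ open w, w p & forall q, w q ->
    (forall i, (N <= i)%N -> phi i q = 0) /\ \sum_(i < N) phi i q = 1].
  by move=> p; have [l H] := fin p; exists l.
have phiN p i : (N p <= i)%N -> phi i p = 0.
  by have [w [_ wp H]] := HN p; have [+ _] := H p wp; apply.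
have phi1 p : \sum_(i < N p) phi i p = 1.
  by have [w [_ wp H]] := HN p; have [_] := H p wp.
pose term s i : preform M := fun p l => phi i p * cone (al i) x s p l.
pose y : cochainA := fun s => if sorted <%O s
  then fun p l => \sum_(i < N p) term s i p l else 0.
have fterm s i : sorted <%O s -> vform F (cover_inter U s) q (term s i).
  move=> ss; apply: (vform_extend (V := U (al i)) (S := S i) (t := cone (al i) x s)) => //.
  - exact: cover_inter_open.
  - by move=> p; exact: phi0.
  apply: (cone_ind (P := vform F (U (al i) `&` cover_inter U s) q)) => //.
  - exact: vform0.
  - by move=> o; exact: vform_opp.
  - move=> t st _ tE; rewrite -cover_inter_cons -(cover_inter_eq tE).
    exact: (aug_vform t mx).
exists y.
  move=> s; case: ifP => [/andP[/eqP sm ss]|nss].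
    rewrite /y ss; apply: vform_local.
      move=> p l np; apply: big1 => i _; have [h1 _ _ _] := fterm s i ss.
      by apply: h1 => -[].
    move=> p up; have [w [ow wp Hw]] := HN p.
    exists w, (\sum_(i < N p) term s i); split=> //.
      by apply: vform_sum => i; exact: fterm.
    move=> p' wp'; apply/funext => l; rewrite sum_preformE.
    apply: (sum_ord_vanish (t := fun i => term s i p' l)) => i iN.
      by rewrite /term phiN ?mul0r.
    by rewrite /term; have [H _] := Hw p' wp'; rewrite H// mul0r.
  rewrite /y; case: ifP => // ss; apply/funext => p; apply/funext => l.
  apply: big1 => i _; rewrite /term.
  rewrite (cone_ind (P := fun o => o = 0) (a := al i) (x := x) ss) ?mulr0//.
    by move=> o ->; rewrite oppr0.
  move=> t st sizet _; have := mx t; rewrite st andbT sizet eqSS.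
  by rewrite ss andbT in nss; rewrite nss.
apply/funext => s; rewrite cech_delta_cobd; case: ifP => ss; last first.
  by have := mx s; rewrite ss andbF.
apply/funext => p; apply/funext => l.
have [up|nup] := pselect (cover_inter U s p); last first.
  by rewrite restr_out//; have [-> //] := aug_vform s mx; case.
rewrite restr_in//.
have sdel i : sorted <%O (del i s).
  apply: (subseq_sorted lt_trans) ss.
  rewrite -{2}(cat_take_drop i s) cat_subseq//.
  by rewrite -add1n -drop_drop drop_subseq.
have cobdE z : cobd z s p l = \sum_(i < size s) (-1) ^+ i * z (del i s) p l.
  by rewrite /cobd sum_preformE.
transitivity (\sum_(i < N p) phi i p * cobd (cone (al i) x) s p l).
  rewrite cobdE (eq_bigr (fun j : 'I_(size s) => \sum_(i < N p)
     (-1) ^+ j * term (del j s) i p l)); last first.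
    by move=> j _; rewrite /y sdel mulr_sumr.
  rewrite exchange_big /=; apply: eq_bigr => i _; rewrite cobdE mulr_sumr.
  by apply: eq_bigr => j _; rewrite /term mulrCA.
transitivity (\sum_(i < N p) phi i p * x s p l); last first.
  by rewrite -mulr_suml phi1 mul1r.
apply: eq_bigr => i _.
have [Sp|nSp] := pselect (S i p); last by rewrite phi0// !mul0r.
congr (_ * _); rewrite -[in RHS](cone_homotopy (al i) x ss).
change (cobd (cone (al i) x) s p l =
  cobd (cone (al i) x) s p l + cone (al i) (cobd x) s p l).
rewrite (cone_ind (P := fun o => o p l = 0) (a := al i) (x := cobd x) ss) ?addr0//.
  by move=> o o0; change (- o p l = 0); rewrite o0 oppr0.
move=> t st _ tE; have := congr1 (fun z : cochainA => z t p l) dx.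
rewrite cech_delta_cobd st restr_in// (cover_inter_eq tE) cover_inter_cons.
by split=> //; exact: SU.
Qed.

End RowExact.

(** * Linear maps inducing isomorphisms in cohomology *)

Section InducedMap.
Context {R : nzRingType} (K L : complex R) (m : nat).
Variable f : cx_sort K m -> cx_sort L m.
Hypothesis f_lin : forall a x y, f (a *: x + y) = a *: f x + f y.
Hypothesis f_cocycle : forall x, x \in @is_cocycle R K m -> f x \in @is_cocycle R L m.
Hypothesis f_coboundary : forall x, x \in @is_cocycle R K m ->
  coboundaries x -> coboundaries (f x).

Definition cocycle_map (z : cocycle K m) : cocycle L m := Cocycle (f_cocycle (valP z)).

Definition coh_map (x : cohomology K m) : cohomology L m :=
  coh_class (cocycle_map (coh_repr x)).

Lemma cocycle_map_lin a z z' :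
  cocycle_map (a *: z + z') = a *: cocycle_map z + cocycle_map z'.
Proof.
apply: val_inj.
change (f (val (a *: z + z')) = val (a *: cocycle_map z + cocycle_map z')).
by rewrite !linearP f_lin.
Qed.

Lemma cocycle_map_sub z z' : cocycle_map (z - z') = cocycle_map z - cocycle_map z'.
Proof. by rewrite -scaleN1r addrC cocycle_map_lin scaleN1r addrC. Qed.

Lemma coh_mapE z : coh_map (coh_class z) = coh_class (cocycle_map z).
Proof.
apply/eqP; rewrite coh_classE -cocycle_map_sub; apply/asboolP.
apply: f_coboundary; first exact: valP.
have : coh_repr (coh_class z) - z \in @is_coboundary R K m.
  by rewrite -coh_classE coh_reprK.
by move=> /asboolP.
Qed.

Lemma coh_map_linear : linear coh_map.
Proof.
move=> a x y; rewrite -[x]coh_reprK -[y]coh_reprK.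
rewrite -[a *: coh_class _]/(coh_scale a (coh_class _)) coh_classZ -coh_classD.
rewrite !coh_mapE cocycle_map_lin coh_classD -coh_classZ.
by [].
Qed.

HB.instance Definition _ := GRing.isLinear.Build R (cohomology K m) (cohomology L m)
  *:%R coh_map coh_map_linear.

Hypothesis f_inj : forall x, x \in @is_cocycle R K m ->
  coboundaries (f x) -> coboundaries x.
Hypothesis f_surj : forall z, z \in @is_cocycle R L m ->
  exists2 x, x \in @is_cocycle R K m & coboundaries (z - f x).

Lemma coh_map_bij : bijective coh_map.
Proof.
rewrite -setTT_bijective; split.
- by [].
- move=> x y _ _; rewrite -[x]coh_reprK -[y]coh_reprK !coh_mapE => /eqP.
  rewrite coh_classE -cocycle_map_sub => /asboolP H.
  apply/eqP; rewrite coh_classE; apply/asboolP; apply: f_inj => //.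
  exact: valP.
- move=> y _; have [x cx bx] := f_surj (valP (coh_repr y)).
  exists (coh_class (Cocycle cx)) => //; rewrite coh_mapE -[RHS]coh_reprK.
  by apply/esym/eqP; rewrite coh_classE; apply/asboolP.
Qed.

Lemma induced_isomorphism : exists Phi : {linear cohomology K m -> cohomology L m},
  bijective Phi /\ forall z : cocycle K m,
    exists2 z' : cocycle L m, cocycle_val z' = f (cocycle_val z) &
      Phi (coh_class z) = coh_class z'.
Proof.
exists coh_map; split; first exact: coh_map_bij.
by move=> z; exists (cocycle_map z) => //; exact: coh_mapE.
Qed.

End InducedMap.

(** * The total complex *)

Section TotalComplex.
Context {R : realType} {n k : nat} {M : manifold R n} (F : foliation M k).
Context {d : Order.disp_t} {A : orderType d} (U : A -> set M).
Hypotheses (Uopen : forall a, open (U a)) (Ucover : \bigcup_a U a = [set: M]).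
Implicit Types (a b : A) (s t : seq A) (o : preform M).
Local Notation cochainA := (@cech_cochain R n M d A : Type).
Local Notation totalA := (@total_cochain R n M d A : Type).
Local Notation delta := (cech_delta U).
Local Notation dC := (cech_dF F U).
Local Notation TD := (total_D F U).

Lemma cech_delta0 : delta 0 = 0.
Proof.
have := cech_delta_lin U 1 (0 : cech_cochain) 0.
by rewrite !scale1r addr0 => /eqP; rewrite -subr_eq subrr eq_sym => /eqP.
Qed.

Lemma cech_dF0 : dC 0 = 0.
Proof. by apply/funext => s; rewrite /cech_dF dF0//; exact: cover_inter_open. Qed.

Lemma cech_delta_mem m q (x : cochainA) : aug_mem F U m q x ->
  aug_mem F U m.+1 q (delta x).
Proof.
move=> mx s; rewrite /cech_delta.
case: (boolP (sorted <%O s)) => ss; last by rewrite andbF.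
rewrite andbT; case: eqP => sm.
  apply: vform_sum => i; apply: vform_scale.
  apply: restr_vform (aug_vform _ mx); first exact: cover_inter_open.
  by apply: cover_inter_sub => a; exact: mem_del.
apply: big1 => i _; have := mx (del i s).
rewrite (_ : size _ == m = false) /=; last first.
  apply/eqP => H; apply: sm; rewrite -H /del size_cat size_drop size_take ltn_ord.
  by have := ltn_ord i; lia.
by move=> ->; rewrite -[0](scale0r (0 : preform M)) restr_scale !scale0r scaler0.
Qed.

Lemma cech_dF_mem m q (x : cochainA) : aug_mem F U m q x ->
  aug_mem F U m q.+1 (dC x).
Proof.
move=> mx s; have := mx s; rewrite /cech_dF; case: ifP => _ H.
  by apply: dF_vform => //; exact: cover_inter_open.
by rewrite H dF0//; exact: cover_inter_open.
Qed.

Lemma dF_scale u q (a : R) o : open u -> vform F u q o ->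
  dF F u (a *: o) = a *: dF F u o.
Proof.
move=> ou fo; have := dF_lin a ou fo (vform0 F u q).
by rewrite dF0// !addr0.
Qed.

Lemma dF_sum u q I (r : seq I) (t : I -> preform M) : open u ->
  (forall i, vform F u q (t i)) ->
  dF F u (\sum_(i <- r) t i) = \sum_(i <- r) dF F u (t i).
Proof.
move=> ou ft; elim: r => [|i r IH]; first by rewrite !big_nil dF0.
rewrite !big_cons -IH.
by have := dF_lin 1 ou (ft i) (vform_sum r ft); rewrite !scale1r.
Qed.

Lemma cech_dF_delta m q (x : cochainA) : aug_mem F U m q x ->
  dC (delta x) = delta (dC x).
Proof.
move=> mx; apply/funext => s; rewrite /cech_dF /cech_delta.
have ou t : open (cover_inter U t) by exact: cover_inter_open.
case: ifP => ss; last by rewrite dF0.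
have sub i : cover_inter U s `<=` cover_inter U (del i s).
  by apply: cover_inter_sub => a; exact: mem_del.
have fr i : vform F (cover_inter U s) q (restr (cover_inter U s) (x (del i s))).
  by apply: restr_vform (aug_vform _ mx).
rewrite (@dF_sum _ q)//; last by move=> i; exact: vform_scale.
apply: eq_bigr => i _; rewrite (dF_scale _ _ (fr i))//; congr (_ *: _).
by rewrite (dF_restr _ _ _ (aug_vform _ mx)).
Qed.

Lemma cech_dF_dF m q (x : cochainA) : aug_mem F U m q x -> dC (dC x) = 0.
Proof.
move=> mx; apply/funext => s; rewrite /cech_dF.
by rewrite (dF_dF _ (aug_vform s mx))//; exact: cover_inter_open.
Qed.

Definition single p q (x : cochainA) : totalA :=
  fun p' q' => if (p' == p) && (q' == q) then x else 0.

Lemma single_mem p q (x : cochainA) : aug_mem F U p.+1 q x ->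
  total_mem F U (p + q)%N (single p q x).
Proof.
move=> mx p' q'; rewrite /single; case: (p' =P p) => [->|np] /=.
  case: (q' =P q) => [->|nq]; first by rewrite eqxx.
  by case: ifP => // _; exact: double_mem0.
by case: ifP => // _; exact: double_mem0.
Qed.

Lemma single0 p q : single p q 0 = 0.
Proof. by apply/funext => p'; apply/funext => q'; rewrite /single; case: ifP. Qed.

Lemma total_D_single p q (x : cochainA) :
  TD (single p q x) = (-1) ^+ p *: single p q.+1 (dC x) + single p.+1 q (delta x).
Proof.
apply/funext => p'; apply/funext => q'.
change (TD (single p q x) p' q' = (-1) ^+ p *: single p q.+1 (dC x) p' q' +
  single p.+1 q (delta x) p' q').
rewrite /total_D addrC /single; congr (_ + _).
  case: (p' =P p) => [->|np] /=; last first.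
    by case: q' => [|q']; rewrite ?cech_dF0 !scaler0.
  case: q' => [|q'] /=; first by rewrite !scaler0.
  by rewrite eqSS; case: eqP => // _; rewrite cech_dF0 !scaler0.
case: p' => [//|p']; rewrite eqSS; case: ifP => // _; exact: cech_delta0.
Qed.

(** The two mixed terms cancel because of the sign in the total differential. *)
Lemma total_D_D_single p q (x : cochainA) : aug_mem F U p.+1 q x ->
  delta (delta x) = 0 -> TD (TD (single p q x)) = 0.
Proof.
move=> mx ddx; rewrite total_D_single.
have m1 := single_mem (cech_dF_mem mx).
have m2 := single_mem (cech_delta_mem mx).
rewrite addnS in m1; rewrite addSn in m2.
rewrite (total_D_lin Uopen _ m1 m2) !total_D_single.
rewrite (cech_dF_dF mx) ddx !single0 (cech_dF_delta mx) scaler0 add0r addr0.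
by rewrite exprS mulN1r scaleNr subrr.
Qed.

(** If [j + 1] is the last column in which [z] is not zero, the component of [D z] in
    column [j + 2] is the Cech coboundary of [z_(j + 1)], hence zero, and
    [z_(j + 1)] is the coboundary of some [t] by exactness of the row. Subtracting
    [D t] empties column [j + 1], and changes neither the differential nor the
    class. *)
Lemma staircase m (y : totalA) : total_mem F U m y ->
  (forall p q, TD y p.+1 q = 0) ->
  exists y' : totalA, [/\ total_mem F U m y', TD y' = TD y,
    (forall p q, y' p.+1 q = 0) &
    @coboundaries R (total_complex F Uopen) m (y - y')].
Proof.
move=> my Dy.
suff H j (z : totalA) : total_mem F U m z -> TD z = TD y ->
    (forall p q, (j < p)%N -> z p q = 0) ->
    exists y' : totalA, [/\ total_mem F U m y', TD y' = TD y,
      (forall p q, y' p.+1 q = 0) &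
      @coboundaries R (total_complex F Uopen) m (z - y')].
  apply: (H m y) => // p q mp; have := my p q; case: eqP => // E _.
  by move: mp; rewrite -E ltnNge leq_addr.
have cb0 : @coboundaries R (total_complex F Uopen) m 0.
  case: (m) => [//|m'] /=; exists 0; first exact: total_mem0.
  have := total_D_lin Uopen 1 (total_mem0 F U m') (total_mem0 F U m').
  by rewrite !scale1r addr0 => /eqP; rewrite -subr_eq subrr eq_sym => /eqP.
elim: j z => [|j IH] z mz Dz z0.
  by exists z; split=> //; [move=> p q; exact: z0 | rewrite subrr].
have [mj|jm] := ltnP m j.+1.
  apply: IH => // p q jp; have := mz p q; case: eqP => // E _.
  by move: mj; rewrite -E ltnS => h; have := leq_ltn_trans h jp; rewrite ltnNge leq_addr.
pose q := (m - j.+1)%N; have mE : (j.+1 + q)%N = m by rewrite subnKC.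
have mzj : aug_mem F U j.+2 q (z j.+1 q).
  by have := mz j.+1 q; rewrite mE eqxx.
have dz : delta (z j.+1 q) = 0.
  have := Dy j.+1 q; rewrite -Dz /total_D.
  have -> : (if q is q'.+1 then dC (z j.+2 q') else 0) = 0.
    by case: (q) => // q'; rewrite z0// cech_dF0.
  by rewrite scaler0 addr0.
have [t mt tE] := row_exact Uopen Ucover mzj dz.
have ddt : delta (delta t) = 0 by rewrite tE.
have mS := single_mem mt.
have DD := total_D_D_single mt ddt.
have mD : total_mem F U m (TD (single j q t)).
  rewrite total_D_single; apply: total_mem_lin.
    by rewrite -mE addSnnS; apply: single_mem; exact: cech_dF_mem.
  by rewrite -mE; apply: single_mem; exact: cech_delta_mem.
pose z' : totalA := -1 *: TD (single j q t) + z.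
have mz' : total_mem F U m z' by exact: total_mem_lin.
have Dz' : TD z' = TD y by rewrite /z' (total_D_lin Uopen _ mD mz) DD scaler0 add0r.
have z'0 p q' : (j < p)%N -> z' p q' = 0.
  move=> jp; rewrite /z' total_D_single.
  change (-1 *: ((-1) ^+ j *: single j q.+1 (dC t) p q' +
    single j.+1 q (delta t) p q') + z p q' = 0).
  rewrite /single gtn_eqF//= scaler0 add0r tE.
  case: (p =P j.+1) => [->|np] /=; last first.
    rewrite scaler0 add0r z0//; move: jp; rewrite leq_eqVlt => /orP[/eqP H|//].
    by case: np.
  case: (q' =P q) => [->|nq]; first by rewrite scaleN1r addNr.
  rewrite scaler0 add0r; have := mz j.+1 q'; case: eqP => // E _.
  by case: nq; apply/eqP; rewrite -(eqn_add2l j.+1) E mE.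
have [y' [my' Dy' y'0 cb]] := IH z' mz' Dz' z'0.
exists y'; split=> //.
have -> : z - y' = 1 *: (TD (single j q t)) + (z' - y').
  by rewrite /z' scale1r scaleN1r !addrA subrr add0r.
move: cb mS; rewrite -[in X in total_mem _ _ X _](_ : (m.-1 = j + q)%N); last by rewrite -mE.
move: mE; case: (m) (z' - y') => [//|m'] z1 _ /= [v mv <-] mS.
exists (1 *: single j q t + v); first exact: total_mem_lin.
exact: (total_D_lin Uopen 1 mS mv).
Qed.

(** * Restriction of global forms *)

(** A global form as a cochain on lists of no index; its Cech coboundary is the
    family of its restrictions to the members of the covering. *)
Definition aug (o : preform M) : cochainA := fun s => if s is [::] then o else 0.

Lemma aug_aug_mem q o : vform F setT q o -> aug_mem F U 0 q (aug o).
Proof. by move=> fo [|a s] //=; rewrite cover_inter_nil. Qed.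

Lemma restr0 w : restr w (0 : preform M) = 0.
Proof. by rewrite -[X in restr _ X](scale0r (0 : preform M)) restr_scale scale0r. Qed.

Lemma delta_aug o s : delta (aug o) s =
  if size s == 1%N then restr (cover_inter U s) o else 0.
Proof.
rewrite /cech_delta; case: s => [|a [|b s]] /=.
- by rewrite big_ord0.
- by rewrite big_ord1 expr0 scale1r.
- case: ifP => // _; apply: big1 => i _.
  rewrite (_ : aug o _ = 0) ?restr0 ?scaler0//.
  by case: i => -[|[|i]].
Qed.

Lemma restriction_single m o : restriction U m o = single 0 m (delta (aug o)).
Proof.
apply/funext => p; apply/funext => q; apply/funext => s.
rewrite /restriction /single; case: (p =P 0%N) => //= _; case: (q =P m) => //= _.
by rewrite delta_aug.
Qed.

Lemma delta_delta_aug o : delta (delta (aug o)) = 0.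
Proof.
apply/funext => s; rewrite [LHS]/cech_delta; case: ifP => // ss.
have [s2|s2] := boolP (size s == 2%N); last first.
  apply: big1 => i _; rewrite delta_aug ifF ?restr0 ?scaler0//.
  apply/negP => /eqP H; move/negP: s2; apply; rewrite -(eqn_add2r 0) -{1}[size s]addn0.
  move: H; rewrite /del size_cat size_drop size_take ltn_ord; have := ltn_ord i; lia.
case: s s2 ss => [|a [|b []]] //= _ _.
rewrite !big_ord_recl big_ord0 addr0 /= !delta_aug /= expr0 scale1r expr1 scaleN1r.
apply/funext => p; apply/funext => l.
change (restr (cover_inter U [:: a; b]) (restr (cover_inter U [:: b]) o) p l -
  restr (cover_inter U [:: a; b]) (restr (cover_inter U [:: a]) o) p l = 0).
have [up|np] := pselect (cover_inter U [:: a; b] p); last first.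
  by rewrite !restr_out// subrr.
rewrite !restr_in ?subrr//; apply: cover_inter_sub up => c;
  by rewrite !inE => ->; rewrite ?orbT.
Qed.

Lemma restriction_mem m o : vform F setT m o -> total_mem F U m (restriction U m o).
Proof.
move=> fo; rewrite restriction_single -[m in total_mem _ _ m]add0n.
by apply: single_mem; apply: cech_delta_mem; exact: aug_aug_mem.
Qed.

Lemma cech_dF_aug o : dC (aug o) = aug (dF F setT o).
Proof.
apply/funext => -[|a s]; rewrite /cech_dF /=; first by rewrite cover_inter_nil.
by rewrite dF0//; exact: cover_inter_open.
Qed.

Lemma restriction_D m o : vform F setT m o ->
  TD (restriction U m o) = restriction U m.+1 (dF F setT o).
Proof.
move=> fo; rewrite !restriction_single total_D_single delta_delta_aug single0 addr0.
by rewrite expr0 scale1r (cech_dF_delta (aug_aug_mem fo)) cech_dF_aug.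
Qed.

Lemma restriction_lin m (a : R) o o' :
  restriction U m (a *: o + o') = a *: restriction U m o + restriction U m o'.
Proof.
apply/funext => p; apply/funext => q; apply/funext => s.
change (restriction U m (a *: o + o') p q s =
  a *: restriction U m o p q s + restriction U m o' p q s).
by rewrite /restriction; case: ifP => // _; rewrite ?restr_lin// scaler0 addr0.
Qed.

Lemma restriction_inj m o : restriction U m o = 0 -> o = 0.
Proof.
move=> H; apply/funext => p; apply/funext => l.
have [a _ Uap] : (\bigcup_a U a) p by rewrite Ucover.
have := congr1 (fun x : totalA => x 0%N m [:: a] p l) H.
rewrite /restriction !eqxx /= restr_in//; apply/cover_interP => b.
by rewrite inE => /eqP ->.
Qed.

(** A total cochain concentrated in the first column is a restriction once its
    differential vanishes off that column. *)
Lemma column_restriction m (y : totalA) : total_mem F U m y ->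
  (forall p q, y p.+1 q = 0) -> (forall p q, TD y p.+1 q = 0) ->
  exists2 o, vform F setT m o & y = restriction U m o.
Proof.
move=> my y0 Dy.
have m0 : aug_mem F U 1 m (y 0%N m) by have := my 0%N m; rewrite add0n eqxx.
have d0 : delta (y 0%N m) = 0.
  have := Dy 0%N m; rewrite /total_D.
  have -> : (if m is q'.+1 then dC (y 1%N q') else 0) = 0.
    by case: (m) => // q'; rewrite y0 cech_dF0.
  by rewrite scaler0 addr0.
have [t mt tE] := row_exact Uopen Ucover m0 d0.
have ft : vform F setT m (t [::]) by have := mt [::]; rewrite /= cover_inter_nil.
exists (t [::]) => //; rewrite restriction_single.
have -> : aug (t [::]) = t by apply/funext => -[|a s] //=; have := mt (a :: s).
rewrite tE; apply/funext => -[|p]; apply/funext => q; rewrite /single /=; last exact: y0.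
by case: (q =P m) => [->//|nq]; have := my 0%N q; rewrite add0n; case: eqP.
Qed.

Lemma is_cocycleP (K : complex R) m (x : cx_sort K m) :
  (x \in @is_cocycle R K m) <-> cx_mem x /\ cx_d x = 0.
Proof. by split=> [/asboolP|H]; last exact/asboolP. Qed.

Lemma restriction0 m : restriction U m 0 = 0.
Proof.
apply/funext => p; apply/funext => q; apply/funext => s.
by rewrite /restriction; case: ifP => //; rewrite restr0.
Qed.

Section Degree.
Variable m : nat.
Local Notation VC := (vertical_complex F).
Local Notation TC := (total_complex F Uopen).

Lemma restriction_cocycle (o : cx_sort VC m) : o \in @is_cocycle R VC m ->
  (restriction U m o : cx_sort TC m) \in @is_cocycle R TC m.
Proof.
move=> /is_cocycleP[fo do0]; apply/is_cocycleP; split; first exact: restriction_mem.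
change (TD (restriction U m o) = 0).
by rewrite restriction_D// [dF _ _ _]do0 restriction0.
Qed.

Lemma restriction_coboundary (o : cx_sort VC m) : o \in @is_cocycle R VC m ->
  coboundaries o -> @coboundaries R TC m (restriction U m o).
Proof.
move=> _; case: m o => [|m'] o /=; first by move=> ->; exact: restriction0.
move=> [b fb <-]; exists (restriction U m' b); first exact: restriction_mem.
exact: restriction_D.
Qed.

Lemma restriction_coboundary_inj (o : cx_sort VC m) : o \in @is_cocycle R VC m ->
  @coboundaries R TC m (restriction U m o) -> coboundaries o.
Proof.
move=> _; case: m o => [|m'] o /=; first exact: restriction_inj.
move=> [y my Dy].
have Dy0 p q : TD y p.+1 q = 0 by rewrite [total_D _ _ _]Dy.
have [y' [my' Dy' y'0 _]] := staircase my Dy0.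
have Dy'0 p q : TD y' p.+1 q = 0 by rewrite Dy'.
have [b fb yb] := column_restriction my' y'0 Dy'0.
exists b => //.
have : restriction U m'.+1 (-1 *: dF F setT b + o) = 0.
  rewrite restriction_lin -restriction_D// -yb Dy' [total_D _ _ _]Dy.
  by rewrite scaleN1r addNr.
by move=> /restriction_inj /eqP; rewrite scaleN1r addrC subr_eq0 => /eqP.
Qed.

Lemma restriction_surj (z : cx_sort TC m) : z \in @is_cocycle R TC m ->
  exists2 o : cx_sort VC m, o \in @is_cocycle R VC m &
    @coboundaries R TC m (z - restriction U m o).
Proof.
move=> /is_cocycleP[mz Dz].
have Dz0 p q : TD z p.+1 q = 0 by rewrite [total_D _ _ _]Dz.
have [y' [my' Dy' y'0 cb]] := staircase mz Dz0.
have Dy'0 p q : TD y' p.+1 q = 0 by rewrite Dy'.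
have [b fb yb] := column_restriction my' y'0 Dy'0.
exists b; last by rewrite -yb.
apply/is_cocycleP; split => //.
apply: (@restriction_inj m.+1); rewrite -restriction_D// -yb Dy'.
exact: Dz.
Qed.

End Degree.
End TotalComplex.

Theorem theorem2p10 (R : realType) (n k : nat) (M : manifold R n)
    (F : foliation M k) (d : Order.disp_t) (A : orderType d)
    (A_countable : countable [set: A]) (U : A -> set M)
    (Uopen : forall a, open (U a)) (Ucover : \bigcup_a U a = [set: M])
    (m : nat) :
  exists Phi : {linear vertical_cohomology F m -> total_cohomology F Uopen m},
    bijective Phi /\
    forall o : cocycle (vertical_complex F) m,
      exists2 z : cocycle (total_complex F Uopen) m,
        cocycle_val z = restriction U m (cocycle_val o) &
        Phi (coh_class o) = coh_class z.
Proof.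
apply: (@induced_isomorphism R (vertical_complex F) (total_complex F Uopen) m
  (restriction U m)).
- exact: restriction_lin.
- exact: restriction_cocycle.
- exact: restriction_coboundary.
- exact: restriction_coboundary_inj.
- exact: restriction_surj.
Qed.
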